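(* Let $x_0>0$, $y_0>0$, $a>0$, $b\ge 0$, $\sigma>0$ with $2a\ge\sigma^2$, let $X=\{X_t,t\ge 0\}$ be the CIR process and $Y=\{Y_t,t\ge0\}$ the squared Bessel process, i.e. the unique non-negative strong solutions of $$X_t = x_0 + \int_0^t (a - b X_s)\,ds + \sigma \int_0^t \sqrt{X_s}\,dW_s,\qquad Y_t = y_0 + a t + \sigma \int_0^t \sqrt{Y_s}\,dW_s,\qquad t\ge 0 .$$ Let $Z=X$ or $Z=Y$, and let $z_0=Z_0$ be the corresponding initial value ($z_0=x_0$ if $Z=X$, $z_0=y_0$ if $Z=Y$). Then for all $t\ge0$, $$\mathbf E\left(\sup_{s \le t} Z_s\right)^2 \le 2\left(\left(z_0 + a t\right)^2 + 2\sigma^2 t\right) e^{4\sigma^2 t}.$$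
   Context: $W=\{W_t,t\ge0\}$ is a Wiener process on a probability space $(\Omega,\mathcal F,\mathbf P)$ and $\mathbf E$ is expectation with respect to $\mathbf P$. Both stochastic differential equations are known to have unique non-negative strong solutions. *)

(* Defs.v *)
From HB Require Import structures.
From mathcomp Require Import all_boot all_order all_algebra.
From mathcomp Require Import all_classical all_reals all_analysis.
From mathcomp Require Import measurable_realfun.

Set Implicit Arguments.
Unset Strict Implicit.
Unset Printing Implicit Defensive.

Import Order.TTheory GRing.Theory Num.Theory.
Import numFieldNormedType.Exports.

Local Open Scope classical_set_scope.
Local Open Scope ring_scope.

(* A real-valued stochastic process is a function R -> T -> R; only its values
   at times t >= 0 are relevant. *)

Section processes.
Context {R : realType} {d : measure_display} {T : measurableType d}.
Implicit Types (P : probability T R) (W Z H I : R -> T -> R).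

Definition measurable_wrt (G : set_system T) (f : T -> R) : Prop :=
  forall B : set R, measurable B -> G (f @^-1` B).

Definition adapted (F : R -> set_system T) Z : Prop :=
  forall t : R, 0 <= t -> measurable_wrt (F t) (Z t).

Definition natural_filtration W (t : R) : set_system T :=
  <<s \bigcup_(u in [set u : R | 0 <= u <= t])
        preimage_set_system setT (W u) measurable >>.

(* The null sets are taken among the measurable sets: T is not assumed to be
   complete, and every member of the augmented filtration is an event. *)
Definition augmented_filtration P W (t : R) : set_system T :=
  <<s natural_filtration W t `|` [set N | measurable N /\ P N = 0%E] >>.

Definition continuous_paths P Z : Prop :=
  {ae P, forall w, {within [set t : R | 0 <= t], continuous (Z ^~ w)}}.

Definition independent_of P (G : set_system T) (f : T -> R) : Prop :=
  forall (A : set T) (B : set R), G A -> measurable B ->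
    P (A `&` f @^-1` B) = (P A * P (f @^-1` B))%E.

Record wiener_process P W : Prop := {
  wiener_measurable : forall t : R, 0 <= t -> measurable_fun setT (W t) ;
  wiener_start : {ae P, forall w, W 0 w = 0} ;
  wiener_continuous : continuous_paths P W ;
  wiener_independent : forall s t : R, 0 <= s -> s < t ->
    independent_of P (natural_filtration W s) (fun w => W t w - W s w) ;
  (* [normal_prob m s] takes the standard deviation [s] *)
  wiener_gaussian : forall s t : R, 0 <= s -> s < t ->
    forall B : set R, measurable B ->
      P ((fun w => W t w - W s w) @^-1` B)
      = normal_prob 0 (Num.sqrt (t - s)) B }.

(* The process sum_(i < sp_size) xi_i 1_(]t_i, t_{i+1}]), where t_i is
   [sp_time i] and xi_i is [sp_val i]. *)
Record simple_process := SimpleProcess {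
  sp_size : nat ;
  sp_time : nat -> R ;
  sp_val : nat -> T -> R }.

Definition adapted_simple (F : R -> set_system T) (phi : simple_process) :=
  [/\ 0 <= sp_time phi 0,
      {homo sp_time phi : i j / (i <= j)%N >-> i <= j} &
      forall i, (i < sp_size phi)%N ->
        measurable_wrt (F (sp_time phi i)) (sp_val phi i) /\
        exists M : R, forall w, `|sp_val phi i w| <= M ].

Definition sp_eval (phi : simple_process) (s : R) (w : T) : R :=
  \sum_(i < sp_size phi)
    sp_val phi i w * \1_(`]sp_time phi i, sp_time phi i.+1]%classic) s.

Definition sp_integral W (phi : simple_process) (t : R) (w : T) : R :=
  \sum_(i < sp_size phi) sp_val phi i w *
    (W (Num.min (sp_time phi i.+1) t) w - W (Num.min (sp_time phi i) t) w).

Definition cvg_in_probability0 P (X : nat -> T -> \bar R) : Prop :=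
  (forall n, measurable_fun setT (X n)) /\
  forall eps : R, 0 < eps ->
    P [set w | (eps%:E <= `|X n w|)%E] @[n --> \oo] --> 0%E.

Definition ito_integrand P (F : R -> set_system T) H : Prop :=
  [/\ adapted F H,
      measurable_fun ([set t : measurableTypeR R | 0 <= t] `*` [set: T])
        (fun p : measurableTypeR R * T => H p.1 p.2) &
      forall t : R, 0 <= t -> {ae P, forall w,
        (\int[lebesgue_measure]_(s in `[0%R, t]) ((H s w) ^+ 2)%:E < +oo)%E} ].

(* [I t] is the stochastic integral of [H] against [W] over [0, t]: the limit
   in probability of the integrals of simple processes which approximate [H]
   in the sense that int_0^t |phi_n - H|^2 ds --> 0 in probability. *)
Definition is_ito_integral P (F : R -> set_system T) W H I : Prop :=
  ito_integrand P F H /\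
  exists phi : nat -> simple_process,
    (forall n, adapted_simple F (phi n)) /\
    forall t : R, 0 <= t ->
      cvg_in_probability0 P (fun n w =>
        (\int[lebesgue_measure]_(s in `[0%R, t])
           ((sp_eval (phi n) s w - H s w) ^+ 2)%:E)%E) /\
      cvg_in_probability0 P (fun n w =>
        (sp_integral W (phi n) t w - I t w)%:E).

(* [Z] is a non-negative strong solution of
     Z_t = A_t + sigma * int_0^t sqrt (Z_s) dW_s,  t >= 0,
   where the term [A] may itself be computed from [Z].  Strong means that [Z]
   is adapted to the augmented filtration of the given Wiener process. *)
Definition strong_sqrt_solution P W (sigma : R) (A Z : R -> T -> R) : Prop :=
  [/\ adapted (augmented_filtration P W) Z,
      continuous_paths P Z,
      {ae P, forall w, forall t : R, 0 <= t -> 0 <= Z t w} &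
      exists I : R -> T -> R,
        is_ito_integral P (augmented_filtration P W) W
          (fun s w => Num.sqrt (Z s w)) I /\
        {ae P, forall w, forall t : R, 0 <= t ->
           Z t w = A t w + sigma * I t w} ].

Definition CIR_process P W (x0 a b sigma : R) (X : R -> T -> R) : Prop :=
  strong_sqrt_solution P W sigma
    (fun t w =>
       x0 + (\int[lebesgue_measure]_(s in `[0%R, t]) (a - b * X s w))%R)
    X.

Definition squared_bessel_process P W (y0 a sigma : R) (Y : R -> T -> R) :
    Prop :=
  strong_sqrt_solution P W sigma (fun t _ => y0 + a * t) Y.

End processes.

(* Main.v *)
(* On [0, t] the drift of Z contributes at most m = z0 + a t, so that
   0 <= Z_s <= m + sigma I_s with I the stochastic integral of sqrt(Z).
   Let V_s be the integral of Z over [0, s].  Stop a simple integrand once its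
   accumulated variance exceeds K: the resulting discrete martingale is square
   integrable, and the pathwise form of Doob's L^2 inequality, in which every
   cross term is (past) * (independent centred increment), controls its maximum.
   Along an almost surely convergent subsequence Fatou's lemma gives, for every
   countable set of times s <= u,
     E sup {I_s^2 : V_s <= K} <= 4 E min(V_u, K).
   The cutoff by V_s <= K replaces localizing stopping times and makes all the
   expectations finite.  As Z <= (1 + Z^2) / 2, the function u |-> E min(V_u, K)
   satisfies a Gronwall inequality whose solution does not depend on K; finally
   let K tend to infinity. *)
Require Import Defs.
From HB Require Import structures.
From mathcomp Require Import all_boot all_order all_algebra.
From mathcomp Require Import all_classical all_reals all_analysis.
From mathcomp Require Import measurable_realfun.
From mathcomp Require Import ring lra.

Set Implicit Arguments.
Unset Strict Implicit.
Unset Printing Implicit Defensive.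

Import Order.TTheory GRing.Theory Num.Theory.
Import numFieldNormedType.Exports.

Local Open Scope classical_set_scope.
Local Open Scope ring_scope.

(** No moment of Z or of its stochastic integral is known beforehand, and a supremum over
    uncountably many times need not be measurable. Hence every estimate passes through a measurable
    majorant that dominates pathwise, and expectations are compared only through such majorants.
    Doob's inequality is taken in pathwise form because it then needs expectations of products of
    independent variables only, and no conditional expectations. Convergence in probability is made
    almost sure by tolerances 2^-n; stage n watches only n of the countably many times, so that one
    simple process serves them all. Constants: Z^2 <= 2 m^2 + 2 sigma^2 I^2 and Doob's factor 4 give
    2 m^2 + 8 sigma^2 E min(V_u, K). The factor 1/2 in Z <= (1 + Z^2) / 2 turns 8 sigma^2 into the
    rate 4 sigma^2 of the exponential, and its summand 1 is the source of the term 2 sigma^2 t in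
    the final bound. The Gronwall inequality is iterated over finite differences, so regularity of u
    |-> E min(V_u, K) never has to be discussed. *)

(** * First two moments of a centred Gaussian law *)

Section gaussian_moments.
Variable R : realType.
Local Notation mu := (@lebesgue_measure R).

Lemma ge0_integral_normal_prob (m s : R) (f : R -> \bar R) :
  (forall x, 0 <= f x)%E -> measurable_fun setT f ->
  (\int[normal_prob m s]_x f x = \int[mu]_x (f x * (normal_pdf m s x)%:E))%E.
Proof.
move=> f0 mf.
have dom := @normal_prob_dominates R m s.
rewrite -(Radon_Nikodym_SigmaFinite.change_of_variables dom f0 _ mf)//.
have iRN := Radon_Nikodym_SigmaFinite.f_integrable dom.
have mpdf : measurable_fun setT (fun x => (normal_pdf m s x)%:E).
  by apply/measurable_EFinP; exact: measurable_normal_pdf.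
apply: ge0_ae_eq_integral => //.
- by apply: emeasurable_funM => //; exact: (measurable_int _ iRN).
- exact: emeasurable_funM.
- by move=> x _; rewrite mule_ge0//; exact: Radon_Nikodym_SigmaFinite.f_ge0.
- by move=> x _; rewrite mule_ge0// lee_fin normal_pdf_ge0.
(* Both functions are densities of the same measure, so they agree almost everywhere. *)
suff : ae_eq mu setT (Radon_Nikodym_SigmaFinite.f (normal_prob m s) mu)
    (fun x => (normal_pdf m s x)%:E).
  by apply: filterS => x /= H _; rewrite H.
apply: integral_ae_eq => // E _ mE.
by rewrite -Radon_Nikodym_SigmaFinite.f_integral.
Qed.

(** Completing the square: the exponential weight moves the mean of the density to [l * s ^+ 2] and
    leaves a constant factor. The moments of the Wiener increments are read off this formula. *)
Lemma normal_prob_mgf (s l : R) : s != 0 ->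
  (\int[normal_prob 0 s]_x (expR (l * x))%:E = (expR (l ^+ 2 * s ^+ 2 / 2))%:E)%E.
Proof.
move=> s0; rewrite ge0_integral_normal_prob//; last first.
  by apply/measurable_EFinP; apply: measurableT_comp => //; exact: measurable_funM.
under eq_integral => x _.
  rewrite -EFinM.
  have -> : expR (l * x) * normal_pdf 0 s x =
            expR (l ^+ 2 * s ^+ 2 / 2) * normal_pdf (l * s ^+ 2) s x.
    rewrite !normal_pdfE//.
    rewrite /normal_fun mulrCA [RHS]mulrCA; congr (_ * _).
    rewrite -!expRD; congr expR; rewrite -mulr_natr; field.
    by rewrite s0.
  rewrite EFinM; over.
rewrite ge0_integralZl//; last 2 first.
- by apply/measurable_EFinP; exact: measurable_normal_pdf.
- by move=> x _; rewrite lee_fin normal_pdf_ge0.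
by rewrite integral_normal_pdf mule1.
Qed.

(* [4 * sinh (y / 2) ^+ 2 >= y ^+ 2] *)
Lemma sqr_le_expRD (y : R) : y ^+ 2 <= expR y + expR (- y) - 2.
Proof.
wlog y0 : y / 0 <= y.
  move=> H; have [/H//|y0] := leP 0 y.
  by have := H (- y); rewrite sqrrN opprK (addrC (expR _)); apply; lra.
pose u := y / 2.
suff : 2 * u <= expR u - expR (- u).
  move=> H; have yu : y = u + u by rewrite /u; field.
  have e1 : expR u * expR (- u) = 1 by rewrite -expRD subrr expR0.
  rewrite {2 3}yu opprD !expRD.
  have u0 : 0 <= u by rewrite /u; lra.
  have -> : y = 2 * u by rewrite yu; ring.
  nra.
have u0 : 0 <= u by rewrite /u; lra.
pose f (x : R) := expR x - expR (- x) - 2 * x.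
have df (x : R) : is_derive x (1 : R) f (expR x + expR (- x) - 2).
  rewrite /f; apply: is_derive_eq.
  by rewrite /GRing.scale/=; ring.
suff : f 0 <= f u by rewrite /f !oppr0 subrr mulr0 sub0r oppr0; lra.
apply: (@ger0_derive1_ndecr _ f 0 u) => //.
- move=> x _; rewrite derive1E (@derive_val _ _ _ _ _ _ _ (df x)).
  have e0 := expR_gt0 x.
  have e1 : expR x * expR (- x) = 1 by rewrite -expRD subrr expR0.
  rewrite -(pmulr_rge0 _ e0) mulrBr mulrDr e1.
  by have := sqr_ge0 (expR x - 1); lra.
- by apply: derivable_within_continuous => x _.
Qed.

Section moments_of_mgf.
Variables (nu : probability (measurableTypeR R) R) (s : R).
Hypotheses (s0 : s != 0)
  (mgf : forall l,
    (\int[nu]_x (expR (l * x))%:E = (expR (l ^+ 2 * s ^+ 2 / 2))%:E)%E).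

Let sqr_le : (\int[nu]_x (x ^+ 2)%:E <= (s ^+ 2)%:E)%E.
Proof.
have mexp (l : R) : measurable_fun setT (fun x : measurableTypeR R => (expR (l * x))%:E).
  by apply/measurable_EFinP; apply: measurableT_comp => //; exact: measurable_funM.
have msq : measurable_fun setT (fun x : measurableTypeR R => (x ^+ 2)%:E).
  by apply/measurable_EFinP; exact: measurable_funX.
(* Integrating [sqr_le_expRD] at [l * x] gives [l^2 E x^2 <= 2 (exp c - 1)], and
   [exp c - 1 <= c exp c] follows from [1 - c <= exp (- c)]. *)
have bound (l : R) : 0 < l ->
    (\int[nu]_x (x ^+ 2)%:E <= (s ^+ 2 * expR (l ^+ 2 * s ^+ 2 / 2))%:E)%E.
  move=> l0; set c := l ^+ 2 * s ^+ 2 / 2.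
  have H : ((l ^+ 2)%:E * \int[nu]_x (x ^+ 2)%:E + 2%:E <=
      \int[nu]_x (expR (l * x))%:E + \int[nu]_x (expR (- l * x))%:E)%E.
    rewrite -ge0_integralZl//; last 2 first.
    - by move=> x _; rewrite lee_fin sqr_ge0.
    - by rewrite lee_fin sqr_ge0.
    have -> : 2%:E = (\int[nu]_x (cst 2%:E x))%E.
      by rewrite integral_cst//= probability_setT mule1.
    have mlsq : measurable_fun setT (fun x : measurableTypeR R => (l ^+ 2)%:E * (x ^+ 2)%:E)%E.
      by apply/measurable_EFinP; apply: measurable_funM => //; exact: measurable_funX.
    have lsq0 (x : R) : setT x -> (0 <= (l ^+ 2)%:E * (x ^+ 2)%:E)%E.
      by move=> _; rewrite mule_ge0// lee_fin sqr_ge0.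
    have exp0 k (x : R) : setT x -> (0 <= (expR (k * x))%:E)%E.
      by move=> _; rewrite lee_fin expR_ge0.
    rewrite -!ge0_integralD//; try exact: exp0; try exact: mexp;
      try by move=> x _; rewrite lee_fin.
    apply: ge0_le_integral => //.
    - by move=> x xT; rewrite adde_ge0 ?lsq0// lee_fin.
    - by apply: emeasurable_funD => //; exact: measurable_cst.
    - by apply: emeasurable_funD; exact: mexp.
    - move=> x _; rewrite -EFinM -!EFinD lee_fin -exprMn mulNr.
      by have := sqr_le_expRD (l * x); lra.
  move: H; rewrite !mgf// sqrrN -/c -EFinD -leeBrDr// -EFinB.
  rewrite muleC -lee_pdivlMr ?exprn_gt0// => /le_trans; apply.
  rewrite lee_fin ler_pdivrMr ?exprn_gt0//.
  have -> : s ^+ 2 * expR c * l ^+ 2 = 2 * (c * expR c) by rewrite /c; field.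
  have e0 := expR_gt0 c; have := expR_ge1Dx (- c).
  have : expR c * expR (- c) = 1 by rewrite -expRD subrr expR0.
  nra.
apply/lee_addgt0Pr => e e0; have s20 : 0 < s ^+ 2 by rewrite exprn_even_gt0.
have es0 : 0 < e / s ^+ 2 by rewrite divr_gt0.
(* For [l ^+ 2 = 2 * y / s ^+ 2] the exponent in [bound] is [y], and the right-hand side becomes
   exactly [s ^+ 2 + e]. *)
pose y := ln (1 + e / s ^+ 2).
have y0 : 0 < y by rewrite ln_gt0// ltrDl.
have l0 : 0 < 2 * y / s ^+ 2 by rewrite divr_gt0// mulr_gt0.
apply: (le_trans (bound (Num.sqrt (2 * y / s ^+ 2)) _)); first by rewrite sqrtr_gt0.
rewrite sqr_sqrtr ?(ltW l0)// -EFinD lee_fin.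
have -> : 2 * y / s ^+ 2 * s ^+ 2 / 2 = y by field.
rewrite lnK ?posrE; last by rewrite addr_gt0.
by rewrite le_eqVlt; apply/orP; left; apply/eqP; field.
Qed.

(* Only [x ^+ 2 <= (exp (l x) + exp (- l x) - 2) / l ^+ 2] and
   [l x <= exp (l x) - 1] are used, for [l] close to 0. *)
Lemma mgf_moments : [/\ (\int[nu]_x (x ^+ 2)%:E <= (s ^+ 2)%:E)%E,
  nu.-integrable setT (fun x : R => x%:E) & (\int[nu]_x x%:E = 0)%E].
Proof.
have msq : measurable_fun setT (fun x : measurableTypeR R => (x ^+ 2)%:E).
  by apply/measurable_EFinP; exact: measurable_funX.
have ix : nu.-integrable setT (fun x : R => x%:E).
  apply: (@le_integrable _ _ _ nu setT _ _ (fun x : R => (1 + x ^+ 2)%:E)) => //.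
  - by apply/measurable_EFinP.
  - move=> x _ /=; rewrite lee_fin (ger0_norm (x := 1 + _)) ?addr_ge0 ?sqr_ge0//.
    by rewrite ler_norml; have := sqr_ge0 (x - 1); have := sqr_ge0 (x + 1); nra.
  - apply/integrableP; split.
      by apply/measurable_EFinP; apply: measurable_funD => //; exact: measurable_funX.
    under eq_integral => x _ do
      rewrite gee0_abs ?lee_fin ?addr_ge0 ?sqr_ge0// EFinD.
    rewrite ge0_integralD//; last by move=> x _; rewrite lee_fin sqr_ge0.
    rewrite integral_cst//= probability_setT mule1.
    by rewrite (le_lt_trans (leeD2l _ (sqr_le)))// -EFinD ltry.
split => //.
have : (\int[nu]_x x%:E)%E \is a fin_num by exact: integrable_fin_num.
move=> /fineK; set m := fine _ => mE; rewrite -mE; congr _%:E.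
have H (l : R) : l * m + 1 <= expR (l ^+ 2 * s ^+ 2 / 2).
  rewrite -lee_fin -(mgf l) EFinD EFinM mE -integralZl//.
  have -> : 1%:E = (\int[nu]_x (cst 1%:E x))%E.
    by rewrite integral_cst//= probability_setT mule1.
  have i1 : nu.-integrable setT (fun x : R => l%:E * x%:E)%E by exact: integrableZl.
  have i2 : nu.-integrable setT (cst 1%:E : R -> \bar R).
    exact: finite_measure_integrable_cst.
  have i3 : nu.-integrable setT (fun x : R => (expR (l * x))%:E).
    apply/integrableP; split.
      by apply/measurable_EFinP; apply: measurableT_comp => //; exact: measurable_funM.
    under eq_integral => x _ do rewrite gee0_abs ?lee_fin ?expR_ge0//.
    by rewrite mgf// ltry.
  rewrite -integralD//; apply: le_integral => //; first exact: integrableD.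
  by move=> x _; rewrite -EFinM -EFinD lee_fin; have := expR_ge1Dx (l * x); lra.
apply/eqP; apply: contraT => m0.
pose q := m ^+ 2; pose k := s ^+ 2 / 2.
have q0 : 0 < q by rewrite exprn_even_gt0.
have k0 : 0 < k by rewrite divr_gt0// exprn_even_gt0.
(* At [l = m / d] the linear term of [H] is [q / d] and its exponent is [y]. The summand [4 * k] of
   [d] ensures [4 y <= q / d], the other two ensure [y <= 1/2], whence [exp y <= 1 + 2 y]; this
   contradicts [1 + 4 y <= exp y]. *)
pose d := 1 + 4 * k + 2 * (k * q).
have kq0 : 0 < k * q by rewrite mulr_gt0.
have d0 : 0 < d by rewrite /d; lra.
pose y := k * q / d / d.
have y0 : 0 < y by rewrite !divr_gt0.
have y1 : y <= 2^-1.
  rewrite /y !ler_pdivrMr// /d; nra.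
have := H (m / d).
have -> : (m / d) ^+ 2 * s ^+ 2 / 2 = y by rewrite /y /k /q; field; rewrite gt_eqF.
have -> : m / d * m = q / d by rewrite /q; field; rewrite gt_eqF.
have yq : 4 * y <= q / d.
  rewrite /y; have -> : 4 * (k * q / d / d) = (q / d) * (4 * k / d) by ring.
  by rewrite ler_piMr ?divr_ge0 ?(ltW q0) ?(ltW d0)// ler_pdivrMr// mul1r /d; lra.
have e0 := expR_gt0 y; have := expR_ge1Dx (- y).
have : expR y * expR (- y) = 1 by rewrite -expRD subrr expR0.
nra.
Qed.
End moments_of_mgf.
End gaussian_moments.

(** * Expectation of a product of two independent variables *)

Section independent_product.
Context d (T : measurableType d) (R : realType) (P : probability T R).
Variables (X Y : T -> R).
Hypotheses (mX : measurable_fun setT X) (mY : measurable_fun setT Y).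
Hypothesis indep : forall A B : set R, measurable A -> measurable B ->
  P (X @^-1` A `&` Y @^-1` B) = (P (X @^-1` A) * P (Y @^-1` B))%E.

Let mX' := isMeasurableFun.Build _ _ _ _ X mX.
Let X' : {mfun T >-> R} := HB.pack X mX'.
Let mY' := isMeasurableFun.Build _ _ _ _ Y mY.
Let Y' : {mfun T >-> R} := HB.pack Y mY'.
Let XY (w : T) : R * R := (X w, Y w).
Let mXY : measurable_fun setT XY.
Proof. exact: measurable_fun_pair. Qed.
Let mXY' := isMeasurableFun.Build _ _ _ _ XY mXY.
Let XY' : {mfun T >-> (R * R)%type} := HB.pack XY mXY'.
Let PX : probability R R := distribution P X'.
Let PY : probability R R := distribution P Y'.
Let PXY : probability (R * R)%type R := distribution P XY'.

(** Independence is this identity on rectangles, and a product measure is determined by its values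
    there. *)
Let joint (A : set (R * R)) : measurable A -> (PX \x PY)%E A = PXY A.
Proof.
by move=> mA; apply: product_measure_unique.
Qed.

Lemma indep_ge0_expectationM (f g : R -> R) :
  (forall x, 0 <= f x) -> (forall x, 0 <= g x) ->
  measurable_fun setT f -> measurable_fun setT g ->
  (\int[P]_w (f (X w) * g (Y w))%:E =
   \int[P]_w (f (X w))%:E * \int[P]_w (g (Y w))%:E)%E.
Proof.
move=> f0 g0 mf mg.
have mfg : measurable_fun [set: R * R] (fun p : R * R => (f p.1 * g p.2)%:E).
  by apply/measurable_EFinP; apply: measurable_funM; apply: measurableT_comp.
have := @ge0_integral_distribution _ _ _ _ _ P XY' _ mfg.
move=> /(_ (fun p => _)) H.
rewrite /= in H; rewrite -H; last by move=> p; rewrite lee_fin mulr_ge0.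
rewrite (eq_measure_integral (PX \x PY)%E); last by move=> A mA _; exact/esym/joint.
rewrite fubini_tonelli1//; last by move=> p; rewrite lee_fin mulr_ge0.
rewrite /fubini_F /=.
have mg' : measurable_fun setT (fun y => (g y)%:E) by exact/measurable_EFinP.
have mf' : measurable_fun setT (fun y => (f y)%:E) by exact/measurable_EFinP.
under eq_integral => x _.
  under eq_integral do rewrite EFinM.
  rewrite ge0_integralZl//; last by rewrite lee_fin.
    2: by move=> y _; rewrite lee_fin.
  over.
rewrite ge0_integralZr//.
- rewrite -(@ge0_integral_distribution _ _ _ _ _ P X' _ mf')//.
  by rewrite -(@ge0_integral_distribution _ _ _ _ _ P Y' _ mg')//.
- by move=> x _; rewrite lee_fin.
- by apply: integral_ge0 => x _; rewrite lee_fin.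
Qed.

(** The non-negative case applied to absolute values gives integrability, after which Fubini's
    theorem applies to the product of the laws. *)
Lemma indep_expectationM :
  P.-integrable setT (EFin \o X) -> P.-integrable setT (EFin \o Y) ->
  P.-integrable setT (fun w => (X w * Y w)%:E) /\
  (\int[P]_w (X w * Y w)%:E = \int[P]_w (X w)%:E * \int[P]_w (Y w)%:E)%E.
Proof.
move=> iX iY.
have iXY : P.-integrable setT (fun w => (X w * Y w)%:E).
  apply/integrableP; split; first by apply/measurable_EFinP; exact: measurable_funM.
  under eq_integral do rewrite abse_EFin normrM.
  rewrite (@indep_ge0_expectationM (fun x : R => `|x|) (fun x : R => `|x|))//.
  have /integrableP[_ X1] := iX; have /integrableP[_ Y1] := iY.
  rewrite lte_mul_pinfty//; first exact: integral_ge0.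
  by rewrite ge0_fin_numE//; exact: integral_ge0.
split => //.
pose h (p : R * R) := (p.1 * p.2)%:E.
have mh : measurable_fun [set: R * R] h.
  by apply/measurable_EFinP; exact: measurable_funM.
have e1 : (\int[P]_w (X w * Y w)%:E = \int[PX \x PY]_p h p)%E.
  rewrite -(@integral_distribution _ _ _ _ _ P XY' h mh)//.
  by apply: eq_measure_integral => A mA _; exact/esym/joint.
have ih : (PX \x PY)%E.-integrable setT h.
  apply/integrableP; split => //.
  have /integrableP[_] := iXY.
  rewrite (eq_measure_integral PXY); last by move=> A mA _; exact: joint.
  have mah : measurable_fun setT (fun p => `|h p|)%E by exact: measurableT_comp.
  by rewrite (@ge0_integral_distribution _ _ _ _ _ P XY' _ mah)//.
rewrite e1 -integral12_prod_meas1//= /fubini_F /h /=.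
have mid : measurable_fun setT (fun y : R => y%:E) by exact/measurable_EFinP.
have iY' : PY.-integrable setT (fun y : R => y%:E).
  apply/integrableP; split => //; have /integrableP[_] := iY.
  have ma : measurable_fun setT (fun y : R => `|y%:E|)%E by exact: measurableT_comp.
  by rewrite (@ge0_integral_distribution _ _ _ _ _ P Y' _ ma)//.
have iX' : PX.-integrable setT (fun y : R => y%:E).
  apply/integrableP; split => //; have /integrableP[_] := iX.
  have ma : measurable_fun setT (fun y : R => `|y%:E|)%E by exact: measurableT_comp.
  by rewrite (@ge0_integral_distribution _ _ _ _ _ P X' _ ma)//.
have EY : (\int[P]_w (Y w)%:E = \int[PY]_y y%:E)%E.
  by rewrite (@integral_distribution _ _ _ _ _ P Y' (fun y => y%:E) mid).
have EX : (\int[P]_w (X w)%:E = \int[PX]_y y%:E)%E.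
  by rewrite (@integral_distribution _ _ _ _ _ P X' (fun y => y%:E) mid).
rewrite EX EY.
under eq_integral => x _.
  under eq_integral do rewrite EFinM.
  rewrite integralZl//.
  over.
have : (\int[PY]_y y%:E)%E \is a fin_num by exact: integrable_fin_num.
by move=> /fineK <-; rewrite integralZr.
Qed.

End independent_product.

(** * Doob's L^2 maximal inequality for a deterministic sequence *)

Section pathwise_doob.
Variable R : realType.
Implicit Types x : nat -> R.

Definition partial_sum x n : R := \sum_(k < n) x k.

Fixpoint running_max x n : R :=
  if n is m.+1 then Num.max (running_max x m) `|partial_sum x m.+1| else 0.

(* Unlike [Num.sg], this has absolute value 1 at 0 too. *)
Definition sgn (y : R) : R := 2 * \1_[set z : R | 0 <= z] y - 1.

Lemma partial_sum0 x : partial_sum x 0 = 0.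
Proof. exact: big_ord0. Qed.

Lemma partial_sumS x n : partial_sum x n.+1 = partial_sum x n + x n.
Proof. exact: big_ord_recr. Qed.

Lemma sgnE (y : R) : sgn y = if 0 <= y then 1 else -1.
Proof.
rewrite /sgn indicE; case: ifPn => y0.
  by rewrite mem_set //=; ring.
by rewrite memNset ?mulr0 ?sub0r//; exact/negP.
Qed.

Lemma norm_sgn (y : R) : `|sgn y| = 1.
Proof. by rewrite sgnE; case: ifP; rewrite ?normrN normr1. Qed.

Lemma running_max_ge0 x n : 0 <= running_max x n.
Proof. by case: n => //= n; rewrite le_max normr_ge0 orbT. Qed.

Lemma running_max_ge x n k : (k <= n)%N -> `|partial_sum x k| <= running_max x n.
Proof.
elim: n k => [|n IH] k; first by rewrite leqn0 => /eqP ->; rewrite partial_sum0 normr0.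
rewrite leq_eqVlt ltnS => /predU1P[->|/IH {}IH] /=; rewrite le_max ?lexx ?orbT//.
by rewrite IH.
Qed.

Lemma running_maxS_le x n : running_max x n.+1 <= running_max x n + `|x n|.
Proof.
rewrite /= ge_max lerDl normr_ge0 partial_sumS (le_trans (ler_normD _ _))// lerD2r.
exact: running_max_ge.
Qed.

(* Abel summation: the right-hand side grows by at least
   [running_max x k * (`|S_k+1| - `|S_k|)] at each step, because the running
   maximum moves only when it equals [`|S_k+1|]. *)
Lemma running_max_abel x n :
  \sum_(k < n) running_max x k * sgn (partial_sum x k) * x k <=
  running_max x n * `|partial_sum x n| - 2^-1 * running_max x n ^+ 2.
Proof.
elim: n => [|n IH]; first by rewrite big_ord0 partial_sum0 normr0 /= expr0n/=; lra.
rewrite big_ord_recr /=.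
have y0 := running_max_ge0 x n.
have ys := running_max_ge x (leqnn n).
(* Convexity of the absolute value: [sgn] is a subgradient of it at the current partial sum. *)
have : sgn (partial_sum x n) * x n <= `|partial_sum x n.+1| - `|partial_sum x n|.
  have e : sgn (partial_sum x n) * partial_sum x n = `|partial_sum x n|.
    rewrite sgnE; case: ifPn => h; first by rewrite mul1r ger0_norm.
    by rewrite mulN1r ltr0_norm// ltNge.
  rewrite lerBrDr partial_sumS -[leRHS]mul1r -(norm_sgn (partial_sum x n)).
  by rewrite -normrM mulrDr e addrC ler_norm.
move: IH y0 ys; set y := running_max x n; set s := `|partial_sum x n|.
set S := \sum_(i < n) _; set z := `|partial_sum x n.+1|.
move=> IH y0 ys Hz.
have {}Hz : y * sgn (partial_sum x n) * x n <= y * (z - s).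
  by rewrite -mulrA ler_wpM2l.
rewrite maxEle; case: ifPn => yz; nra.
Qed.

(** With s = |S_n| and y the running maximum, [running_max_abel] bounds the right-hand side from
    below by [4 s^2 - 4 y s + 2 y^2 = y^2 + (2 s - y)^2]. The coefficient of [x k] in the linear
    part involves earlier terms only: in expectation that part will vanish and Doob's constant 4
    remains in front of the squares. *)
Lemma sqr_running_max_le x n :
  running_max x n ^+ 2 <=
  \sum_(k < n) ((8 * partial_sum x k - 4 * running_max x k * sgn (partial_sum x k))
                 * x k + 4 * x k ^+ 2).
Proof.
have sq m : partial_sum x m ^+ 2 = \sum_(k < m) (2 * partial_sum x k * x k + x k ^+ 2).
  elim: m => [|m IH]; first by rewrite big_ord0 partial_sum0 expr0n.
  by rewrite big_ord_recr/= -IH partial_sumS; ring.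
have -> : \sum_(k < n) ((8 * partial_sum x k
    - 4 * running_max x k * sgn (partial_sum x k)) * x k + 4 * x k ^+ 2) =
    4 * partial_sum x n ^+ 2 -
    4 * \sum_(k < n) running_max x k * sgn (partial_sum x k) * x k.
  rewrite sq !mulr_sumr -sumrB; apply: eq_bigr => k _; ring.
have := running_max_abel x n.
set S := \sum_(i < n) _; set y := running_max x n.
rewrite -[in X in _ -> _ <= X](real_normK (num_real (partial_sum x n))).
by set s := `|_| => H; have := sqr_ge0 (2 * s - y); nra.
Qed.
End pathwise_doob.

(** * Measurability with respect to a generated sigma-algebra *)

Section generated_measurability.
Context d (T : measurableType d) (R : realType).
Implicit Types (G : set_system T) (f : T -> R).

(** Makes the closure properties of measurable functions available for the sigma-algebras of a
    filtration. *)
Lemma measurable_wrtP G f :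
  measurable_wrt <<s G >> f <->
  measurable_fun [set: g_sigma_algebraType G] (f : g_sigma_algebraType G -> R).
Proof.
split=> [mf _ B mB|mf B mB]; first by rewrite setTI; exact: mf.
by have := mf measurableT B mB; rewrite setTI.
Qed.

Lemma measurable_wrt_sub G G' f :
  G `<=` G' -> measurable_wrt G f -> measurable_wrt G' f.
Proof. by move=> GG' mf B mB; apply/GG'/mf. Qed.

Lemma measurable_wrt_measurable_fun G f :
  G `<=` measurable -> measurable_wrt G f -> measurable_fun setT f.
Proof. by move=> Gm mf _ B mB; rewrite setTI; apply/Gm/mf. Qed.

Lemma measurable_sgn : measurable_fun setT (@sgn R).
Proof.
rewrite /sgn; apply: measurable_funB => //; apply: measurable_funM => //.
apply: measurable_indic.
rewrite (_ : [set z : R | 0 <= z] = `[0, +oo[%classic) //.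
by apply/seteqP; split=> z /=; rewrite in_itv/= andbT.
Qed.

End generated_measurability.

(** * Maximal inequality for a discrete martingale transform *)

Section martingale_transform.
Context d (T : measurableType d) (R : realType) (P : probability T R).
Variables (G : nat -> set_system T) (psi D : nat -> T -> R).
Variables (delta : nat -> R) (C : R).
Hypotheses (Gm : forall k, <<s G k >> `<=` measurable)
  (Gnd : forall k, <<s G k >> `<=` <<s G k.+1 >>)
  (psim : forall k, measurable_wrt <<s G k >> (psi k))
  (psiC : forall k w, `|psi k w| <= C)
  (Dm : forall k, measurable_wrt <<s G k.+1 >> (D k))
  (Dindep : forall k, independent_of P <<s G k >> (D k))
  (Dint : forall k, P.-integrable setT (EFin \o D k))
  (D0 : forall k, (\int[P]_w (D k w)%:E = 0)%E)
  (D2 : forall k, (\int[P]_w (D k w ^+ 2)%:E <= (delta k)%:E)%E).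

Let x w k := psi k w * D k w.
Let M k w := partial_sum (x w) k.
Let sb k w := running_max (x w) k.

Let mM k : measurable_wrt <<s G k >> (M k).
Proof.
elim: k => [|k IH].
  apply/measurable_wrtP; rewrite (_ : M 0 = cst 0)//.
  by apply/funext => w; rewrite /M partial_sum0.
rewrite (_ : M k.+1 = M k \+ (psi k \* D k)); last first.
  by apply/funext => w; rewrite /M partial_sumS.
apply/measurable_wrtP; apply: measurable_funD.
  by apply/measurable_wrtP; exact: (measurable_wrt_sub (@Gnd k) IH).
apply: measurable_funM; apply/measurable_wrtP => //.
exact: (measurable_wrt_sub (@Gnd k) (@psim k)).
Qed.

Let msb k : measurable_wrt <<s G k >> (sb k).
Proof.
elim: k => [|k IH]; first by apply/measurable_wrtP; exact: measurable_cst.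
apply/measurable_wrtP; apply: measurable_maxr.
  by apply/measurable_wrtP; exact: (measurable_wrt_sub (@Gnd k) IH).
by apply: measurableT_comp => //; apply/measurable_wrtP; exact: mM.
Qed.

Let mT k (f : T -> R) : measurable_wrt <<s G k >> f -> measurable_fun setT f.
Proof. by move=> mf; apply: measurable_wrt_measurable_fun mf; exact: Gm. Qed.

(** This must come before the maximal inequality: the coefficients [eta k] are controlled by
    [1 + sb k ^+ 2], and only integrable terms may be integrated one by one. One step uses
    [(v + z)^2 <= 2 v^2 + 2 z^2]. *)
Let isb2 k : P.-integrable setT (fun w => (sb k w ^+ 2)%:E).
Proof.
elim: k => [|k IH].
  by under eq_fun do rewrite /sb /= expr0n; exact: integrable0.
have iD2 : P.-integrable setT (fun w => (D k w ^+ 2)%:E).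
  apply/integrableP; split.
    by apply/measurable_EFinP/measurable_funX; exact: mT (@Dm k).
  under eq_integral => w _ do rewrite gee0_abs ?lee_fin ?sqr_ge0//.
  by rewrite (le_lt_trans (D2 k))// ltry.
pose h w := ((2%:E * (sb k w ^+ 2)%:E + (2 * C ^+ 2)%:E * (D k w ^+ 2)%:E)%E).
apply: (@le_integrable _ _ _ P setT _ _ h) => //.
- by apply/measurable_EFinP/measurable_funX; exact: mT (@msb k.+1).
- move=> w _; rewrite /h -!EFinM -!EFinD !abse_EFin lee_fin !ger0_norm ?sqr_ge0//; last first.
    by have := sqr_ge0 (sb k w); have := sqr_ge0 (C * D k w); rewrite exprMn; lra.
  have H := running_maxS_le (x w) k; have s0 := running_max_ge0 (x w) k.+1.
  have H2 : `|x w k| ^+ 2 <= C ^+ 2 * D k w ^+ 2.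
    rewrite /x normrM exprMn (real_normK (num_real (D k w))).
    by rewrite ler_wpM2r ?sqr_ge0// lerXn2r ?nnegrE// (le_trans _ (psiC k w)).
  have t0 := running_max_ge0 (x w) k.
  move: H H2 s0 t0; rewrite -!/(sb _ w); set u := sb k.+1 w; set v := sb k w.
  set z := `|x w k|; set e := C ^+ 2 * _ => uvz ze u0 v0.
  have z0 : 0 <= z by exact: normr_ge0.
  rewrite -mulrA -/e; have : u ^+ 2 <= (v + z) ^+ 2 by rewrite lerXn2r ?nnegrE ?addr_ge0.
  by have := sqr_ge0 (v - z); nra.
- by apply: integrableD => //; exact: integrableZl.
Qed.

(** The factor of [D k w] in the linear part of [sqr_running_max_le]; it is known before the
    increment [D k], hence independent of it. *)
Let eta k w := (8 * M k w - 4 * sb k w * sgn (M k w)) * psi k w.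

Let meta k : measurable_wrt <<s G k >> (eta k).
Proof.
apply/measurable_wrtP; apply: measurable_funM; last exact/measurable_wrtP.
have mMk := (measurable_wrtP _ _).1 (@mM k).
have msk := (measurable_wrtP _ _).1 (@msb k).
apply: measurable_funB; first exact: measurable_funM.
apply: measurable_funM; first exact: measurable_funM.
by apply: measurableT_comp => //; exact: measurable_sgn.
Qed.

Let ieta k : P.-integrable setT (EFin \o eta k).
Proof.
(* As [|M| <= sb], the bracket in [eta] is at most [(8 + 4) sb], and [sb <= 1 + sb^2]. *)
pose h w := ((12 * C) %:E * (1 + (sb k w ^+ 2)%:E))%E.
apply: (@le_integrable _ _ _ P setT _ _ h) => //.
- by apply/measurable_EFinP; exact: mT (@meta k).
- move=> w _; rewrite /h -EFinD -!EFinM !abse_EFin lee_fin.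
  have C0 : 0 <= C by rewrite (le_trans _ (psiC 0 w)).
  rewrite [leRHS]ger0_norm; last by rewrite !mulr_ge0// addr_ge0// sqr_ge0.
  have -> : 12 * C * (1 + sb k w ^+ 2) = (12 * (1 + sb k w ^+ 2)) * C by ring.
  rewrite /eta normrM ler_pM//.
  apply: (le_trans (ler_normB _ _)); rewrite !normrM norm_sgn mulr1.
  rewrite !(@ger0_norm _ 8) ?(@ger0_norm _ 4)//.
  have := running_max_ge (x w) (leqnn k); have := running_max_ge0 (x w) k.
  rewrite -!/(sb _ w) -!/(M _ w) => s0 Ms; rewrite (ger0_norm s0).
  by have := sqr_ge0 (2 * sb k w - 1); nra.
- apply: integrableZl => //; apply: integrableD => //.
  exact: finite_measure_integrable_cst.
Qed.

Let indepM k : P.-integrable setT (fun w => (eta k w * D k w)%:E) /\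
  (\int[P]_w (eta k w * D k w)%:E = 0)%E.
Proof.
have ind A B : measurable A -> measurable B ->
    P (eta k @^-1` A `&` D k @^-1` B) = (P (eta k @^-1` A) * P (D k @^-1` B))%E.
  by move=> mA mB; rewrite Dindep//; exact: meta.
have [i ->] := indep_expectationM (mT (@meta k)) (mT (@Dm k)) ind (ieta k) (Dint k).
by rewrite D0 mule0.
Qed.

Let indepsq k : (\int[P]_w (4 * x w k ^+ 2)%:E <=
  4%:E * (delta k)%:E * \int[P]_w (psi k w ^+ 2)%:E)%E.
Proof.
under eq_integral do rewrite EFinM.
have mx : measurable_fun setT (fun w => x w k).
  by apply: measurable_funM; [exact: mT (@psim k)|exact: mT (@Dm k)].
rewrite ge0_integralZl//; last 2 first.
- by apply/measurable_EFinP; exact: measurable_funX.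
- by move=> w _; rewrite lee_fin sqr_ge0.
rewrite -muleA; apply: lee_wpmul2l => //.
under eq_integral do rewrite /x exprMn.
have ind A B : measurable A -> measurable B ->
    P (psi k @^-1` A `&` D k @^-1` B) = (P (psi k @^-1` A) * P (D k @^-1` B))%E.
  by move=> mA mB; rewrite Dindep//; exact: psim.
have msq : measurable_fun setT (fun y : R => y ^+ 2) by exact: measurable_funX.
rewrite (indep_ge0_expectationM (mT (@psim k)) (mT (@Dm k)) ind
  (fun y => sqr_ge0 y) (fun y => sqr_ge0 y) msq msq).
rewrite muleC; apply: lee_wpmul2r => //.
by apply: integral_ge0 => w _; rewrite lee_fin sqr_ge0.
Qed.

Lemma sqr_running_max_expectation n :
  (\int[P]_w (running_max (fun k => psi k w * D k w) n ^+ 2)%:E <=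
   4%:E * \sum_(k < n) (delta k)%:E * \int[P]_w (psi k w ^+ 2)%:E)%E.
Proof.
pose S m w := \sum_(k < m) (eta k w * D k w + 4 * x w k ^+ 2).
have C0 : 0 <= C by rewrite (le_trans _ (psiC 0 point)).
have mx k : measurable_fun setT (fun w => x w k).
  by apply: measurable_funM; [exact: mT (@psim k)|exact: mT (@Dm k)].
have ix k : P.-integrable setT (fun w => (4 * x w k ^+ 2)%:E).
  apply/integrableP; split.
    by apply/measurable_EFinP; apply: measurable_funM => //; exact: measurable_funX.
  under eq_integral => w _ do
    rewrite gee0_abs ?lee_fin ?(mulr_ge0 (ler0n _ _) (sqr_ge0 _))//.
  apply: (le_lt_trans (indepsq k)); rewrite -muleA lte_mul_pinfty//.
  rewrite lte_mul_pinfty//.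
  - by rewrite (le_trans _ (D2 k))//; apply: integral_ge0 => w _; rewrite lee_fin sqr_ge0.
  - apply: (@le_lt_trans _ _ (\int[P]_w (cst (C ^+ 2)%:E w))%E); last first.
      by rewrite integral_cst//= probability_setT mule1 ltry.
    apply: ge0_le_integral => //.
    + by move=> w _; rewrite lee_fin sqr_ge0.
    + by apply/measurable_EFinP; apply: measurable_funX; exact: mT (@psim k).
    + move=> w _; rewrite lee_fin -[leLHS]real_normK ?num_real//.
      by rewrite lerXn2r ?nnegrE.
have iS m : P.-integrable setT (EFin \o S m) /\
    (\int[P]_w (S m w)%:E <=
     4%:E * \sum_(k < m) (delta k)%:E * \int[P]_w (psi k w ^+ 2)%:E)%E.
  elim: m => [|m [IH1 IH2]].
    split.
      rewrite (_ : _ \o _ = cst 0%E) ?integrable0//.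
      by apply/funext => w; rewrite /S/= big_ord0.
    under eq_integral do rewrite /S big_ord0.
    by rewrite integral0 big_ord0 mule0.
  have [ie e0] := indepM m.
  have iT : P.-integrable setT (fun w => (eta m w * D m w)%:E + (4 * x w m ^+ 2)%:E)%E.
    exact: integrableD.
  rewrite (_ : EFin \o S m.+1 = (EFin \o S m) \+
      (fun w => (eta m w * D m w)%:E + (4 * x w m ^+ 2)%:E)%E); last first.
    by apply/funext => w; rewrite /S/= big_ord_recr/= EFinD.
  split; first exact: integrableD.
  under eq_integral do rewrite /S big_ord_recr/= EFinD EFinD.
  rewrite integralD// integralD// e0 add0e big_ord_recr/=.
  rewrite ge0_muleDr; first by rewrite leeD// muleA indepsq.
  - apply: sume_ge0 => k _; rewrite mule_ge0//.
      by rewrite (le_trans _ (D2 k))//; apply: integral_ge0 => w _; rewrite lee_fin sqr_ge0.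
    by apply: integral_ge0 => w _; rewrite lee_fin sqr_ge0.
  - rewrite mule_ge0//.
      by rewrite (le_trans _ (D2 m))//; apply: integral_ge0 => w _; rewrite lee_fin sqr_ge0.
    by apply: integral_ge0 => w _; rewrite lee_fin sqr_ge0.
have [iSn] := iS n; apply: le_trans.
apply: le_integral => //; first exact: isb2.
move=> w _; rewrite lee_fin (le_trans (sqr_running_max_le _ _))//.
apply: ler_sum => k _; rewrite -!/(x w) -/(M k w) -/(sb k w) -/(x w k).
by rewrite /eta /x !mulrA lexx.
Qed.
End martingale_transform.

(** * Wiener increments and the augmented filtration *)

Section augmented_wiener.
Context d (T : measurableType d) (R : realType) (P : probability T R).
Variable W : R -> T -> R.
Hypothesis HW : wiener_process P W.
Local Notation F := (augmented_filtration P W).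

Lemma natural_filtration_measurable t : natural_filtration W t `<=` measurable.
Proof.
apply: smallest_sub; first exact: sigma_algebra_measurable.
move=> A [u /andP[u0 ut] [B mB <-]].
exact: (wiener_measurable HW u0).
Qed.

Lemma augmented_filtration_measurable t : F t `<=` measurable.
Proof.
apply: smallest_sub; first exact: sigma_algebra_measurable.
by move=> A [/natural_filtration_measurable//|[]].
Qed.

Lemma augmented_filtration_nd s t : s <= t -> F s `<=` F t.
Proof.
move=> st; apply: sub_smallest2r; first exact: smallest_sigma_algebra.
move=> A [nA|nA]; [left|by right].
move: A nA; apply: sub_smallest2r; first exact: smallest_sigma_algebra.
move=> A [u /andP[u0 us] pA]; exists u => //=.
by rewrite u0 (le_trans us).
Qed.

Lemma wiener_adapted u t : 0 <= u -> u <= t -> measurable_wrt (F t) (W u).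
Proof.
move=> u0 ut B mB; apply: sub_sigma_algebra; left; apply: sub_sigma_algebra.
exists u; first by rewrite /= u0.
by exists B => //; rewrite setTI.
Qed.

(** The sets with such an approximation form a sigma-algebra that contains the generators of [F s];
    a null set is approximated by [set0]. This carries independence over from the natural
    filtration. *)
Lemma augmented_natural s A : F s A ->
  exists A' N, [/\ natural_filtration W s A', measurable N, P N = 0%E &
    forall w, ~ N w -> (A w <-> A' w)].
Proof.
move: A; apply: smallest_sub.
  split.
  - by exists set0, set0; split => //; exact: sigma_algebra0.
  - move=> A [A' [N [nA' mN N0 AA']]]; exists (~` A'), N; split => //.
      by rewrite -setTD; exact: sigma_algebraCD.
    by move=> w /AA' [h1 h2]; split=> [[_ nA] /h2//|nA]; split => // /h1.
  - move=> A /(_ _)/cid-/all_sig[A' /(_ _)/cid-/all_sig[N HA]].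
    exists (\bigcup_n A' n), (\bigcup_n N n); split.
    + by apply: sigma_algebra_bigcup => n; have [] := HA n.
    + by apply: bigcup_measurable => n _; have [] := HA n.
    + apply/negligibleP; first by apply: bigcup_measurable => n _; have [] := HA n.
      apply: negligible_bigcup => n; have [? mN N0 _] := HA n.
      exact/negligibleP.
    + move=> w nN; split=> -[n _ An]; exists n => //; have [_ _ _ AA'] := HA n;
      by apply/AA' => // Nn; apply: nN; exists n.
move=> A [nA|[mA A0]]; first by exists A, set0; split.
by exists set0, A; split => //; exact: sigma_algebra0.
Qed.

(** The case [s = t] is included because a merged grid may repeat a point; every preimage under the
    zero increment is empty or everything. *)
Lemma wiener_augmented_independent s t : 0 <= s -> s <= t ->
  independent_of P (F s) (fun w => W t w - W s w).
Proof.
move=> s0; rewrite le_eqVlt => /predU1P[->|st] A B FA mB.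
  have [B0|B0] := pselect (B 0).
    rewrite (_ : _ @^-1` B = setT) ?setIT ?probability_setT ?mule1//.
    by apply/seteqP; split => // w _ /=; rewrite subrr.
  rewrite (_ : _ @^-1` B = set0) ?setI0 ?measure0 ?mule0//.
  by apply/seteqP; split => // w /=; rewrite subrr.
have mWB : measurable ((fun w => W t w - W s w) @^-1` B).
  rewrite -[X in measurable X]setTI; apply: measurable_funB => //.
  - exact: (wiener_measurable HW (le_trans s0 (ltW st))).
  - exact: (wiener_measurable HW s0).
have [A' [N [nA' mN N0 AA']]] := augmented_natural FA.
have mA := augmented_filtration_measurable FA.
have mA' := natural_filtration_measurable nA'.
have swap E : measurable E -> P (A `&` E) = P (A' `&` E).
  move=> mE; apply/eqP; rewrite eq_le; apply/andP; split.
    apply: (@le_trans _ _ (P ((A' `&` E) `|` N))).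
      rewrite le_measure ?inE//; first exact: measurableI.
        by apply: measurableU => //; exact: measurableI.
      move=> w [Aw Ew]; have [Nw|Nw] := pselect (N w); first by right.
      by left; split => //; apply/AA'.
    rewrite -[leRHS]adde0 -N0; apply: measureU2 => //; exact: measurableI.
  apply: (@le_trans _ _ (P ((A `&` E) `|` N))).
    rewrite le_measure ?inE//; first exact: measurableI.
      by apply: measurableU => //; exact: measurableI.
    move=> w [Aw Ew]; have [Nw|Nw] := pselect (N w); first by right.
    by left; split => //; apply/AA'.
  rewrite -[leRHS]adde0 -N0; apply: measureU2 => //; exact: measurableI.
have PAA' : P A = P A' by rewrite -(setIT A) swap// setIT.
by rewrite swap// PAA' (wiener_independent HW s0 st).
Qed.

Lemma wiener_increment_moments s t : 0 <= s -> s <= t ->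
  let D w := W t w - W s w in
  [/\ P.-integrable setT (EFin \o D), (\int[P]_w (D w)%:E = 0)%E &
    (\int[P]_w (D w ^+ 2)%:E <= (t - s)%:E)%E].
Proof.
move=> s0; rewrite le_eqVlt => /predU1P[->|st] D.
  have -> : D = cst 0 by apply/funext => w; rewrite /D subrr.
  split; first exact: integrable0.
  - by rewrite integral0.
  - by under eq_integral do rewrite expr0n; rewrite integral0 subrr.
have mD : measurable_fun setT D.
  apply: measurable_funB => //.
  - exact: (wiener_measurable HW (le_trans s0 (ltW st))).
  - exact: (wiener_measurable HW s0).
pose mD' := isMeasurableFun.Build _ _ T (measurableTypeR R) D mD.
pose D' : {mfun T >-> measurableTypeR R} := HB.pack D mD'.
have sd0 : Num.sqrt (t - s) != 0 by rewrite gt_eqF// sqrtr_gt0 subr_gt0.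
have [] := @mgf_moments _ (distribution P D') _ sd0.
  move=> l; rewrite -normal_prob_mgf//.
  by apply: eq_measure_integral => B mB _; exact: (wiener_gaussian HW s0 st mB).
have mid : measurable_fun setT (fun y : measurableTypeR R => y%:E) by exact/measurable_EFinP.
have msq : measurable_fun setT (fun y : measurableTypeR R => (y ^+ 2)%:E).
  by apply/measurable_EFinP; exact: measurable_funX.
rewrite (@ge0_integral_distribution _ _ _ _ _ P D' _ msq)//; last first.
  by move=> y; rewrite lee_fin sqr_ge0.
rewrite sqr_sqrtr ?subr_ge0 ?(ltW st)// => D2 iD mean0.
have iD' : P.-integrable setT (EFin \o D).
  apply/integrableP; split; first exact/measurable_EFinP.
  have /integrableP[_] := iD.
  have ma : measurable_fun setT (fun y : measurableTypeR R => `|y%:E|)%E by exact: measurableT_comp.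
  by rewrite (@ge0_integral_distribution _ _ _ _ _ P D' _ ma).
split => //.
by rewrite -mean0 (@integral_distribution _ _ _ _ _ P D' _ mid).
Qed.
End augmented_wiener.

(** * Simple integrals along a common refinement of two sets of times *)

Section merged_grid.
Context d (T : measurableType d) (R : realType).
Variables (phi : @simple_process R d T) (t : R) (s : seq R).
Local Notation tm := (sp_time phi).
Local Notation N := (sp_size phi).
Hypotheses (tm0 : 0 <= tm 0%N) (tm_nd : {homo tm : i j / (i <= j)%N >-> i <= j}).
Hypotheses (t0 : 0 <= t) (st : {in s, forall u, 0 <= u <= t}).

(** Merging the jump times of [phi], cut off at [t], with the observation times [s] makes the
    integral at each observation time a partial sum of one and the same transform. The length [N.+1]
    counts both ends of the N intervals. *)
Definition grid_points : seq R :=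
  sort <=%R ([seq Num.min (tm i) t | i <- iota 0 N.+1] ++ s).

(** The default [t] makes the grid monotone on all of [nat], and equal to [t] at the index
    [size grid_points]. *)
Definition grid (k : nat) : R := nth t grid_points k.

Lemma grid_pointsP u : u \in grid_points -> 0 <= u <= t.
Proof.
rewrite mem_sort mem_cat => /orP[/mapP[i _ ->]|/st//].
rewrite ge_min lexx orbT andbT le_min t0 andbT.
by rewrite (le_trans tm0)// tm_nd.
Qed.

Lemma grid_itv k : 0 <= grid k <= t.
Proof.
rewrite /grid; have [kn|kn] := ltnP k (size grid_points).
  exact/grid_pointsP/mem_nth.
by rewrite nth_default// t0 lexx.
Qed.

Lemma grid_nd k l : (k <= l)%N -> grid k <= grid l.
Proof.
move=> kl; have [ln|ln] := ltnP l (size grid_points).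
  rewrite /grid; apply: sorted_leq_nth => //.
  - exact: le_trans.
  - exact: sort_le_sorted.
  - by rewrite inE (leq_ltn_trans kl).
by rewrite {2}/grid nth_default//; have /andP[] := grid_itv k.
Qed.

Lemma grid_index u : u \in grid_points -> grid (index u grid_points) = u.
Proof. exact: nth_index. Qed.

Lemma grid0_le u : u \in grid_points -> grid 0 <= u.
Proof. by move=> us; rewrite -[leRHS](grid_index us) grid_nd. Qed.

Lemma grid_gap u k : u \in grid_points -> u < grid k.+1 -> u <= grid k.
Proof.
move=> us; rewrite -(grid_index us); set p := index _ _ => uk.
have [//|kp] := leP (grid p) (grid k).
have : (k < p)%N by rewrite ltnNge; apply: contraTN kp => pk; rewrite -leNgt grid_nd.
by move=> /grid_nd; rewrite leNgt uk.
Qed.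

Lemma grid_time i : (i <= N)%N -> Num.min (tm i) t \in grid_points.
Proof.
move=> iN; rewrite mem_sort mem_cat; apply/orP; left.
by apply/mapP; exists i => //; rewrite mem_iota.
Qed.

Lemma grid_time_gap i k : (i <= N)%N -> tm i < grid k.+1 -> tm i <= grid k.
Proof.
move=> iN ik; have /andP[_ kt] := grid_itv k.+1.
have e : Num.min (tm i) t = tm i by apply/min_idPl; rewrite (le_trans (ltW ik)).
by rewrite -e; apply: grid_gap; rewrite ?grid_time// e.
Qed.

(** As [a] and [b] are grid points, no nondegenerate grid step straddles them, so the selected steps
    are consecutive. The minima with [grid p] account for a sum that stops early. *)
Lemma grid_telescope (g : R -> R) a b p : a \in grid_points -> b \in grid_points ->
  a <= b ->
  \sum_(k < p) (a < grid k.+1 <= b)%R%:R * (g (grid k.+1) - g (grid k)) =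
  g (Num.min b (grid p)) - g (Num.min a (grid p)).
Proof.
move=> aG bG ab; elim: p => [|p IH].
  by rewrite big_ord0 !(min_idPr _) ?grid0_le// subrr.
rewrite big_ord_recr/= IH.
have [e|pp] := eqVneq (grid p) (grid p.+1); first by rewrite e subrr mulr0 addr0.
have {}pp : grid p < grid p.+1 by rewrite lt_neqAle pp grid_nd.
have [ap|pa] /= := ltP a (grid p.+1); last first.
  have b1 : grid p.+1 <= b by rewrite (le_trans pa).
  have a1 := le_trans (ltW pp) pa.
  by rewrite mul0r addr0 !(min_idPr _) ?subrr// (le_trans (ltW pp)).
have ap' := grid_gap aG ap.
rewrite (min_idPl ap').
have [pb|bp] /= := leP (grid p.+1) b.
  by rewrite (min_idPr _) ?(le_trans (ltW pp))// mul1r; ring.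
have bp' := grid_gap bG bp.
by rewrite mul0r addr0 (min_idPl bp').
Qed.

Variable W : R -> T -> R.

(** After exchanging the sums, the grid steps inside each interval of [phi] telescope. The integrand
    is sampled at the right end of a step because the intervals of [phi] are left-open. *)
Lemma sp_integral_grid p w :
  sp_integral W phi (grid p) w =
  \sum_(k < p) sp_eval phi (grid k.+1) w * (W (grid k.+1) w - W (grid k) w).
Proof.
under [RHS]eq_bigr do rewrite /sp_eval mulr_suml.
rewrite exchange_big /=; apply: eq_bigr => i _.
have pt k : grid k <= t by have /andP[] := grid_itv k.
have mint x k : Num.min (Num.min x t) (grid k) = Num.min x (grid k).
  by rewrite -minA (min_idPr (pt k)).
have iN := ltn_ord i.
have ab : Num.min (tm i) t <= Num.min (tm i.+1) t.
  by rewrite le_min ge_min tm_nd// ge_min lexx orbT.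
rewrite -(mint (tm i.+1)) -(mint (tm i)).
rewrite -(grid_telescope (W ^~ w) p (grid_time (ltnW iN)) (grid_time iN) ab).
rewrite mulr_sumr; apply: eq_bigr => k _; rewrite -mulrA; congr (_ * (_ * _)).
rewrite indicE mem_setE; congr (_%:R).
rewrite in_itv/= gt_min le_min pt andbT; congr (nat_of_bool (_ && _)).
by rewrite [X in _ || X]ltNge pt orbF.
Qed.

Lemma sp_eval_grid k u w : grid k < u <= grid k.+1 ->
  sp_eval phi u w = sp_eval phi (grid k.+1) w.
Proof.
move=> /andP[ku uk]; apply: eq_bigr => i _; congr (_ * _).
have iN := ltn_ord i.
rewrite !indicE !mem_setE !in_itv/=; congr (_%:R).
have -> : (tm i < u) = (tm i < grid k.+1).
  apply/idP/idP => [iu|ik]; first exact: lt_le_trans uk.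
  by rewrite (le_lt_trans _ ku)// grid_time_gap// ltnW.
congr (nat_of_bool (_ && _)); apply/idP/idP => [ui|]; last exact: le_trans.
by rewrite leNgt; apply/negP => /(grid_time_gap iN) ik; move: ku; rewrite ltNge (le_trans ui).
Qed.

End merged_grid.

(** * Maximal inequality for simple integrands, stopped at variance K *)

Section simple_ito.
Context d (T : measurableType d) (R : realType) (P : probability T R).
Variable W : R -> T -> R.
Hypothesis HW : wiener_process P W.
Local Notation F := (augmented_filtration P W).
Local Notation mu := (@lebesgue_measure R).

Lemma sp_eval_bounded (phi : @simple_process R d T) : adapted_simple F phi ->
  exists C : R, forall u w, `|sp_eval phi u w| <= C.
Proof.
move=> [_ _ aphi].
have /choice[M HM] : forall i, exists M : R, (i < sp_size phi)%N ->
    forall w, `|sp_val phi i w| <= M.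
  move=> i; have [iN|Ni] := pselect (i < sp_size phi)%N; last by exists 0 => /Ni.
  by have [_ [M HM]] := aphi i iN; exists M.
exists (\sum_(i < sp_size phi) M i) => u w.
apply: (le_trans (ler_norm_sum _ _ _)); apply: ler_sum => i _.
rewrite normrM; apply: le_trans (HM i (ltn_ord i) w).
rewrite ler_piMr//; rewrite indicE; case: (_ \in _); by rewrite ?normr1 ?normr0.
Qed.

Lemma measurable_sp_eval (phi : @simple_process R d T) w D :
  measurable_fun D (fun u : measurableTypeR R => sp_eval phi u w).
Proof.
by rewrite /sp_eval; apply: measurable_sum => i; apply: measurable_funM.
Qed.

Variables (phi : @simple_process R d T) (t K : R) (s : seq R).
Hypotheses (aphi : adapted_simple F phi) (t0 : 0 <= t) (K0 : 0 <= K).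
Hypothesis st : {in s, forall u, 0 <= u <= t}.

Let tm0 : 0 <= sp_time phi 0%N. Proof. by case: aphi. Qed.
Let tm_nd : {homo sp_time phi : i j / (i <= j)%N >-> i <= j}.
Proof. by case: aphi. Qed.

Let r := grid phi t s.
Let r_nd : forall k l, (k <= l)%N -> r k <= r l.
Proof. by move=> k l; exact: grid_nd. Qed.
Let r0 k : 0 <= r k.
Proof. by have /andP[] := grid_itv tm0 tm_nd t0 st k. Qed.
Let xi k w := sp_eval phi (r k.+1) w.
Let dl k := r k.+1 - r k.
Let V k w := \sum_(j < k) xi j w ^+ 2 * dl j.
(* [V k.+1] only involves [xi 0, ..., xi k], so the stopped integrand is still
   adapted. *)
Let psi k w := if V k.+1 w <= K then xi k w else 0.
Let D k w := W (r k.+1) w - W (r k) w.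

Let dl0 k : 0 <= dl k. Proof. by rewrite subr_ge0 r_nd. Qed.

Let V_nd w k l : (k <= l)%N -> V k w <= V l w.
Proof.
move=> /subnK <-; elim: (l - k)%N => [//|m IH]; apply: (le_trans IH).
by rewrite addSn /V [leRHS]big_ord_recr/= lerDl mulr_ge0 ?sqr_ge0.
Qed.

(* [phi] is constant on the left-open interval from [r k] to [r k.+1], hence
   its value at [r k.+1] is known at time [r k]. *)
Let mxi k : measurable_wrt (F (r k)) (xi k).
Proof.
apply/measurable_wrtP; rewrite /xi /sp_eval; apply: measurable_sum => i.
have [ik|ki] := ltP (sp_time phi i) (r k.+1); last first.
  rewrite (_ : (fun _ => _) = cst 0)//; apply/funext => w.
  rewrite indicE mem_setE in_itv/= ltNge ki/= mulr0//.
apply: measurable_funM => //; apply/measurable_wrtP.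
have [_ _ /(_ i (ltn_ord i))[mi _]] := aphi.
apply: (measurable_wrt_sub _ mi); apply: augmented_filtration_nd.
by apply: grid_time_gap => //; exact: ltnW.
Qed.

Let mpsi k : measurable_wrt (F (r k)) (psi k).
Proof.
apply/measurable_wrtP; apply: measurable_fun_ifT => //; last first.
  by apply/measurable_wrtP; exact: mxi.
apply: measurable_fun_ler => //; apply: measurable_sum => j.
apply: measurable_funM => //; apply: measurable_funX.
apply/measurable_wrtP; apply: measurable_wrt_sub (@mxi j).
by apply: augmented_filtration_nd; rewrite r_nd// -ltnS.
Qed.

(** There is no overshoot beyond K: the test in [psi k] is on [V k.+1], so the very step that would
    pass K is already dropped. *)
Let sum_psi_le k w : \sum_(j < k) dl j * psi j w ^+ 2 <= Num.min (V k w) K.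
Proof.
rewrite le_min; apply/andP; split.
  apply: ler_sum => j _; rewrite mulrC ler_wpM2r// /psi.
  by case: ifP => //; rewrite expr0n sqr_ge0.
elim: k => [|k IH]; first by rewrite big_ord0.
have [VK|VK] := leP (V k.+1 w) K; last first.
  have p0 : psi k w = 0 by rewrite /psi leNgt VK.
  by rewrite big_ord_recr/= p0 expr0n mulr0 addr0.
apply: le_trans VK; apply: ler_sum => j _; rewrite mulrC ler_wpM2r// /psi.
by case: ifP => //; rewrite expr0n sqr_ge0.
Qed.

(** The part of the integral over [[0, r 0]] is merely bounded below by 0; after it the integrand is
    constant on each left-open grid step. *)
Let V_le k w : ((V k w)%:E <= \int[mu]_(u in `[0%R, r k]) (sp_eval phi u w ^+ 2)%:E)%E.
Proof.
have msq (A : set (measurableTypeR R)) : measurable_fun A (fun u => (sp_eval phi u w ^+ 2)%:E).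
  by apply/measurable_EFinP; apply: measurable_funX; exact: measurable_sp_eval.
elim: k => [|k IH].
  by rewrite /V big_ord0 integral_ge0// => u _; rewrite lee_fin sqr_ge0.
rewrite (@itv_bndbnd_setU _ _ (BLeft 0) (BRight (r k)) (BRight (r k.+1)))//; last 2 first.
- by rewrite bnd_simp.
- by rewrite bnd_simp r_nd.
rewrite ge0_integral_setU//=; last 2 first.
- by move=> u _; rewrite lee_fin sqr_ge0.
- apply/disj_setPLR => u /=; rewrite !in_itv/= => /andP[_ uk].
  by apply/negP; rewrite negb_and -leNgt uk.
rewrite /V big_ord_recr/= EFinD leeD//.
rewrite (eq_integral (fun=> (xi k w ^+ 2)%:E)); last first.
  move=> u; rewrite inE/= in_itv/= => ku; congr (_ ^+ 2)%:E.
  exact: (sp_eval_grid tm0 tm_nd t0 st).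
rewrite integral_cst//= lebesgue_measure_itv/= lte_fin.
have [kk|kk] := ltP (r k) (r k.+1); first by rewrite -EFinD -EFinM.
by rewrite mule0 lee_fin mulr_ge0_le0// ?sqr_ge0// subr_le0.
Qed.

(** The free majorant [B] lets the variance of the limit plus an error term be inserted directly,
    and spares the measurability in [w] of the integral of the squared simple process. *)
Lemma simple_ito_doob : exists Q : T -> R,
  [/\ measurable_fun setT Q,
      (forall w, 0 <= Q w),
      (forall B : T -> \bar R, measurable_fun setT B ->
         (forall w, mine (\int[mu]_(u in `[0%R, t]) (sp_eval phi u w ^+ 2)%:E) K%:E
                    <= B w)%E ->
         (\int[P]_w (Q w)%:E <= 4%:E * \int[P]_w B w)%E) &
      (forall u w, u \in s ->
         (\int[mu]_(v in `[0%R, u]) (sp_eval phi v w ^+ 2)%:E <= K%:E)%E ->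
         sp_integral W phi u w ^+ 2 <= Q w)].
Proof.
have [C HC] := sp_eval_bounded aphi.
pose n := size (grid_points phi t s).
pose G k := natural_filtration W (r k) `|` [set N | measurable N /\ P N = 0%E].
have Gm k : <<s G k >> `<=` measurable by exact: augmented_filtration_measurable.
have Gnd k : <<s G k >> `<=` <<s G k.+1 >>.
  by apply: (@augmented_filtration_nd _ _ _ P W (r k) (r k.+1)); exact: r_nd.
have psiC k w : `|psi k w| <= C.
  by rewrite /psi; case: ifP => _; [exact: HC|rewrite normr0 (le_trans _ (HC 0 w))].
have Dm k : measurable_wrt <<s G k.+1 >> (D k).
  by apply/measurable_wrtP; apply: measurable_funB; apply/measurable_wrtP;
     apply: wiener_adapted => //; exact: r_nd.
have Dind k : independent_of P <<s G k >> (D k).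
  exact: (wiener_augmented_independent HW (r0 k) (r_nd (leqnSn k))).
have mom k := wiener_increment_moments HW (r0 k) (r_nd (leqnSn k)).
have Dint k : P.-integrable setT (EFin \o D k) by have [] := mom k.
have D0 k : (\int[P]_w (D k w)%:E = 0)%E by have [] := mom k.
have D2 k : (\int[P]_w (D k w ^+ 2)%:E <= (dl k)%:E)%E by have [] := mom k.
have main := @sqr_running_max_expectation _ _ _ P G psi D dl C Gm Gnd (@mpsi) psiC Dm
  Dind Dint D0 D2 n.
have mpsiT k : measurable_fun setT (psi k).
  exact: (measurable_wrt_measurable_fun (Gm k) (@mpsi k)).
have mDT k : measurable_fun setT (D k).
  exact: (measurable_wrt_measurable_fun (Gm k.+1) (Dm k)).
have rn : r n = t by rewrite /r /grid nth_default.
exists (fun w => running_max (fun k => psi k w * D k w) n ^+ 2); split.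
- apply: measurable_funX; elim: (n) => [|m IH] /=; first exact: measurable_cst.
  apply: measurable_maxr => //; apply: measurableT_comp => //.
  by rewrite /partial_sum; apply: measurable_sum => k; exact: measurable_funM.
- by move=> w; exact: sqr_ge0.
- move=> B mB HB; apply: (le_trans main); apply: lee_wpmul2l => //.
  have mdp k : measurable_fun setT (fun w => ((dl k)%:E * (psi k w ^+ 2)%:E)%E).
    by apply/measurable_EFinP; apply: measurable_funM => //; exact: measurable_funX.
  have -> : (\sum_(k < n) ((dl k)%:E * \int[P]_w (psi k w ^+ 2)%:E) =
      \int[P]_w \sum_(k < n) ((dl k)%:E * (psi k w ^+ 2)%:E))%E.
    rewrite ge0_integral_sum//; last first.
      by move=> k w _; rewrite mule_ge0// lee_fin ?sqr_ge0.
    apply: eq_bigr => k _; rewrite ge0_integralZl//.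
    + by apply/measurable_EFinP; exact: measurable_funX.
    + by move=> w _; rewrite lee_fin sqr_ge0.
    + by rewrite lee_fin.
  apply: ge0_le_integral => //.
  + by move=> w _; apply: sume_ge0 => k _; rewrite mule_ge0// lee_fin ?sqr_ge0.
  + by apply: emeasurable_sum => k; exact: mdp.
  + move=> w _; apply: le_trans (HB w).
    under eq_bigr do rewrite -EFinM.
    rewrite sumEFin le_min.
    have := sum_psi_le n w; rewrite le_min => /andP[h1 h2].
    rewrite lee_fin h2 andbT -rn.
    by apply: le_trans (V_le n w); rewrite lee_fin.
- move=> u w us HK.
  have uG : u \in grid_points phi t s by rewrite mem_sort mem_cat us orbT.
  pose p := index u (grid_points phi t s).
  have rp : r p = u by exact: grid_index.
  have pn : (p <= n)%N by rewrite ltnW// index_mem.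
  have VK : V p w <= K by rewrite -lee_fin; apply: le_trans HK; rewrite -rp V_le.
  (* For [k < p] one has [V k.+1 <= V p <= K], so the stopping has not yet acted. *)
  have -> : sp_integral W phi u w = partial_sum (fun k => psi k w * D k w) p.
    rewrite -rp /r sp_integral_grid// /partial_sum; apply: eq_bigr => k _.
    by rewrite /psi (le_trans _ VK)// V_nd.
  rewrite -[leLHS]real_normK ?num_real// lerXn2r ?nnegrE//.
    exact: running_max_ge0.
  exact: running_max_ge.
Qed.
End simple_ito.

(** * Lower limits and a perturbation bound for integrals of squares *)

Section limit_tools.
Variable R : realType.

Lemma ge_limn_einf (u : (\bar R)^nat) (x : \bar R) :
  (\forall n \near \oo, u n <= x)%E -> (limn_einf u <= x)%E.
Proof.
move=> [m _ um]; rewrite limn_einf_lim; apply: lime_le; first exact: is_cvg_einfs.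
apply: nearW => n; apply: (@le_trans _ _ (u (maxn m n))).
  by apply: ereal_inf_lbound; exists (maxn m n) => //=; exact: leq_maxr.
by apply: um; exact: leq_maxl.
Qed.

Lemma le_limn_einf (u : (\bar R)^nat) (x : \bar R) :
  (\forall n \near \oo, x <= u n)%E -> (x <= limn_einf u)%E.
Proof.
move=> [m _ um]; rewrite limn_einf_lim; apply: lime_ge; first exact: is_cvg_einfs.
exists m => // n /= mn; apply: le_ereal_inf_tmp => _ [k /= nk <-].
by apply: um; exact: (leq_trans mn).
Qed.

Lemma measurable_fun_limn_einf d (T : measurableType d) (f : (T -> \bar R)^nat) :
  (forall n, measurable_fun setT (f n)) ->
  measurable_fun setT (fun x => limn_einf (f ^~ x)).
Proof.
move=> mf; rewrite /limn_einf; apply: measurableT_comp => //.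
by apply: measurable_fun_limn_esup => n; exact: measurableT_comp.
Qed.

Local Notation mu := (@lebesgue_measure R).

(** Young's inequality with a weight: the factor of the main term tends to 1 with [e], so Doob's
    constant 4 survives the passage to the limit. *)
Lemma integral_sqr_le (A : set (measurableTypeR R)) (e : R)
    (f g : measurableTypeR R -> R) :
  measurable A -> 0 < e -> measurable_fun A f -> measurable_fun A g ->
  (\int[mu]_(x in A) (f x ^+ 2)%:E <=
   (1 + e)%:E * \int[mu]_(x in A) (g x ^+ 2)%:E +
   (1 + e^-1)%:E * \int[mu]_(x in A) ((f x - g x) ^+ 2)%:E)%E.
Proof.
move=> mA e0 mf mg.
have e10 : 0 <= 1 + e^-1 by rewrite addr_ge0// invr_ge0 ltW.
have e20 : 0 <= 1 + e by rewrite addr_ge0// ltW.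
have sq0 (h : R -> R) (x : R) : (0 <= (h x ^+ 2)%:E)%E by rewrite lee_fin sqr_ge0.
have mB : measurable_fun A (fun x => ((f x - g x) ^+ 2)%:E).
  by apply/measurable_EFinP; apply: measurable_funX; exact: measurable_funB.
have mG : measurable_fun A (fun x => (g x ^+ 2)%:E).
  by apply/measurable_EFinP; exact: measurable_funX.
have mF : measurable_fun A (fun x => (f x ^+ 2)%:E).
  by apply/measurable_EFinP; exact: measurable_funX.
rewrite -ge0_integralZl// -ge0_integralZl//.
have m1 : measurable_fun A (fun x => (1 + e)%:E * (g x ^+ 2)%:E)%E.
  exact: emeasurable_funM.
have m2 : measurable_fun A (fun x => (1 + e^-1)%:E * ((f x - g x) ^+ 2)%:E)%E.
  exact: emeasurable_funM.
rewrite -ge0_integralD//; last 2 first.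
- by move=> x _; rewrite mule_ge0// sq0.
- by move=> x _; rewrite mule_ge0// (sq0 (f \- g)).
apply: ge0_le_integral => //; first exact: emeasurable_funD.
move=> x _; rewrite -!EFinM -EFinD lee_fin.
set a := g x; have -> : f x = a + (f x - a) by ring.
set h := f x - a; have -> : a + h - a = h by ring.
rewrite -subr_ge0.
have -> : (1 + e) * a ^+ 2 + (1 + e^-1) * h ^+ 2 - (a + h) ^+ 2 =
    e^-1 * (e * a - h) ^+ 2 by field; rewrite gt_eqF.
by rewrite mulr_ge0 ?sqr_ge0// invr_ge0 ltW.
Qed.

End limit_tools.

(** * Measurability of the accumulated variance *)

Section ito_integrand_variance.
Context d (T : measurableType d) (R : realType) (P : probability T R).
Variables (F : R -> set_system T) (H : R -> T -> R).
Hypothesis iH : ito_integrand P F H.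
Local Notation mu := (@lebesgue_measure R).

Let joint (u : R) : measurable_fun setT
  ((fun p : measurableTypeR R * T => (H p.1 p.2 ^+ 2)%:E) \_ (`[0, u] `*` setT)).
Proof.
have mD : measurable ((`[0, u] : set (measurableTypeR R)) `*` [set: T]).
  exact: measurableX.
apply/(measurable_restrictT _ mD).
apply/measurable_EFinP; apply: measurable_funX.
have [_ mH _] := iH; apply: measurable_funS mH.
  apply: measurableX => //.
  rewrite (_ : [set t : R | 0 <= t] = `[0, +oo[%classic) //.
  by apply/seteqP; split=> z /=; rewrite in_itv/= andbT.
by move=> -[x w] [/= + _]; rewrite in_itv/= => /andP[].
Qed.

Lemma ito_integrand_section u w :
  measurable_fun (`[0, u] : set (measurableTypeR R)) (fun r => H r w).
Proof.
have [_ mH _] := iH.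
pose f (r : measurableTypeR R) : measurableTypeR R * T := (r, w).
have mf : measurable_fun `[0, u] f by apply: measurable_funTS; exact: pair2_measurable.
apply: (@measurable_comp _ _ _ _ _ _
  ([set t : measurableTypeR R | 0 <= t] `*` [set: T]) _ _ f _ _ mH mf).
  apply: measurableX => //.
  rewrite (_ : [set t : R | 0 <= t] = `[0, +oo[%classic) //.
  by apply/seteqP; split=> z /=; rewrite in_itv/= andbT.
by move=> _ [r /= + <-]; rewrite in_itv/= => /andP[r0 _]; split.
Qed.

Lemma measurable_integral_sqr u : measurable_fun setT
  (fun w => \int[mu]_(r in `[0%R, u]) (H r w ^+ 2)%:E)%E.
Proof.
have := @measurable_fun_fubini_tonelli_G _ _ (measurableTypeR R) T R mu _ (joint u).
move=> /(_ _)/=; set g := fubini_G _ _; move=> h.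
rewrite (_ : (fun _ => _) = g).
  apply: h => -[r w]; rewrite patchE; case: ifP => // _.
  by rewrite lee_fin sqr_ge0.
apply/funext => w; rewrite /g /fubini_G [LHS]integral_mkcond.
apply: eq_integral => r _.
rewrite !patchE/=; congr (if _ then _ else _).
by apply/idP/idP; rewrite !inE/= => -[]//.
Qed.

End ito_integrand_variance.

(** * Maximal inequality for the stochastic integral *)

Section ito_maximal_inequality.
Context d (T : measurableType d) (R : realType) (P : probability T R).
Variables (W H I : R -> T -> R).
Hypothesis HW : wiener_process P W.
Local Notation F := (augmented_filtration P W).
Local Notation mu := (@lebesgue_measure R).
Hypothesis itoI : is_ito_integral P F W H I.
Let V u w := (\int[mu]_(r in `[0%R, u]) ((H r w) ^+ 2)%:E)%E.

Variables (t K : R) (s : nat -> R).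
Hypotheses (t0 : 0 <= t) (K0 : 0 <= K) (st : forall i, 0 <= s i <= t).

Let e (n : nat) : R := 2^-1 ^+ n.
Let e0 n : 0 < e n. Proof. by rewrite exprn_gt0. Qed.
Let e1 n : e n <= 1. Proof. by rewrite exprn_ile1// invf_le1// ler1n. Qed.

Let dist (phi : simple_process) w : \bar R :=
  (\int[mu]_(r in `[0%R, t]) ((sp_eval phi r w - H r w) ^+ 2)%:E)%E.
(** Index 0 tests the integrand, index [j.+1] the integral at time [s j]. The third power
    compensates the factor [1 + (e n)^-1] of [integral_sqr_le]. *)
Let far (phi : simple_process) n (i : nat) : set T :=
  if i is j.+1 then
    [set w | ((e n)%:E <= `|(sp_integral W phi (s j) w - I (s j) w)%:E|)%E]
  else [set w | ((e n ^+ 3)%:E <= `|dist phi w|)%E].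
Let bad (phi : simple_process) n : set T := \big[setU/set0]_(i < n.+1) far phi n i.

Let good_approximation n : exists phi : simple_process,
  [/\ adapted_simple F phi, measurable (bad phi n) & (P (bad phi n) <= (e n)%:E)%E].
Proof.
have [_ [phi [aphi cphi]]] := itoI.
have mfar m i : measurable (far (phi m) n i).
  have mle (X : T -> \bar R) (c : R) : measurable_fun setT X ->
      measurable [set w | (c%:E <= `|X w|)%E].
    move=> mX; rewrite -[X in measurable X]setTI.
    by apply: emeasurable_fun_c_infty => //; exact: measurableT_comp.
  case: i => [|j] /=.
    by apply: (mle (dist (phi m))); have [[+ _] _] := cphi t t0; exact.
  apply: (mle (fun w => (sp_integral W (phi m) (s j) w - I (s j) w)%:E)).
  by have /andP[s0 _] := st j; have [_ [+ _]] := cphi (s j) s0; exact.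
(* Each of the [n.+1] tests gets an equal share of the probability [e n], for the union bound. *)
have small i : \forall m \near \oo, (P (far (phi m) n i) <= (e n / n.+1%:R)%:E)%E.
  have c0 : 0 < e n / n.+1%:R by rewrite divr_gt0.
  have {}small (X : nat -> T -> \bar R) (c : R) : 0 < c -> cvg_in_probability0 P X ->
      \forall m \near \oo, (P [set w | (c%:E <= `|X m w|)%E] <= (e n / n.+1%:R)%:E)%E.
    move=> cc [_ /(_ c cc) /fine_cvgP[fX /cvgrPdist_le /(_ _ c0) HX]].
    near=> m.
    have fm : P [set w | (c%:E <= `|X m w|)%E] \is a fin_num by near: m.
    rewrite -(fineK fm) lee_fin.
    have : `|0 - fine (P [set w | (c%:E <= `|X m w|)%E])| <= e n / n.+1%:R by near: m.
    by rewrite sub0r normrN; apply: le_trans; exact: ler_norm.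
  case: i => [|j] /=.
    by apply: (small (fun m => dist (phi m))); [rewrite exprn_gt0|have [] := cphi t t0].
  have /andP[s0 _] := st j.
  apply: (small (fun m w => (sp_integral W (phi m) (s j) w - I (s j) w)%:E)) => //.
  by have [] := cphi (s j) s0.
have : \forall m \near \oo, forall i : 'I_n.+1,
    (P (far (phi m) n i) <= (e n / n.+1%:R)%:E)%E.
  by apply: filter_forall => i; exact: small.
move=> [m _ /(_ m (leqnn m)) Pm].
have mbad : measurable (bad (phi m) n) by apply: bigsetU_measurable => i _; exact: mfar.
exists (phi m); split => //.
apply: (le_trans (Boole_inequality P (A := far (phi m) n) (fun i _ => mfar m i))).
apply: (@le_trans _ _ (\sum_(i < n.+1) (e n / n.+1%:R)%:E)%E).
  by apply: lee_sum => i _; exact: Pm.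
by rewrite sumEFin lee_fin sumr_const card_ord -[leLHS]mulr_natr divfK.
Unshelve. all: by end_near. Qed.

Lemma ito_doob : exists Q : T -> \bar R,
  [/\ measurable_fun setT Q,
      (forall w, 0 <= Q w)%E,
      (\int[P]_w Q w <= 4%:E * \int[P]_w mine (V t w) K%:E)%E &
      {ae P, forall w, forall i, (V (s i) w <= K%:E -> (I (s i) w ^+ 2)%:E <= Q w)%E}].
Proof.
have [iH _] := itoI.
have [phi Hphi] := choice good_approximation.
pose b n := bad (phi n) n.
have mb n : measurable (b n) by have [] := Hphi n.
have Pb n : (P (b n) <= (e n)%:E)%E by have [] := Hphi n.
(* leaves room for the error (1 + e n) V + 2 e n below when V <= K *)
pose Kn n := K + e n * (K + 2).
have Kn0 n : 0 <= Kn n by rewrite addr_ge0// mulr_ge0 ?(ltW (e0 n))// addr_ge0.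
have sn n : {in mkseq s n, forall u, 0 <= u <= t}.
  by move=> u /mapP[i _ ->].
have aphi n : adapted_simple F (phi n) by have [] := Hphi n.
have [Qn HQ] := choice (fun n => simple_ito_doob HW (aphi n) t0 (Kn0 n) (sn n)).
(* int phi_n^2 <= (1 + e) V + (1 + 1/e) e^3 <= (1 + e) V + 2 e *)
have approx n w u : ~ b n w -> 0 <= u <= t ->
    (\int[mu]_(r in `[0%R, u]) (sp_eval (phi n) r w ^+ 2)%:E <=
     (1 + e n)%:E * V u w + (2 * e n)%:E)%E.
  move=> nb /andP[u0 ut].
  have mphi (A : set (measurableTypeR R)) : measurable_fun A (fun r => sp_eval (phi n) r w).
    exact: measurable_sp_eval.
  have mH v : measurable_fun (`[0, v] : set (measurableTypeR R)) (fun r => H r w).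
    exact: (ito_integrand_section iH).
  apply: (le_trans (integral_sqr_le _ (e0 n) (mphi _) (mH u))) => //.
  apply: leeD2l.
  have dn : (\int[mu]_(x in `[0%R, u]) ((sp_eval (phi n) x w - H x w) ^+ 2)%:E
      <= (e n ^+ 3)%:E)%E.
    apply: (@le_trans _ _ (dist (phi n) w)).
      apply: ge0_subset_integral => //.
      - by apply/measurable_EFinP; apply: measurable_funX; exact: measurable_funB.
      - by move=> r _; rewrite lee_fin sqr_ge0.
      - by apply: subset_itvl; rewrite bnd_simp.
    rewrite leNgt; apply/negP => H1; apply: nb.
    rewrite /b /bad -bigcup_mkord; exists 0%N => //=.
    by rewrite (le_trans (ltW H1))// lee_abs.
  apply: (le_trans (lee_wpmul2l _ dn)).
    by rewrite lee_fin addr_ge0// invr_ge0 ltW.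
  rewrite -EFinM lee_fin.
  have -> : (1 + (e n)^-1) * e n ^+ 3 = e n ^+ 3 + e n ^+ 2 by field; rewrite gt_eqF.
  by have := e0 n; have := e1 n; rewrite exprS; nra.
have esmall (g : R) : 0 < g -> \forall n \near \oo, e n <= g.
  move=> g0.
  have ecv : e n @[n --> \oo] --> (0 : R).
    by apply: cvg_expr; rewrite ger0_norm// invf_lt1// ltr1n.
  have /cvgrPdist_le/(_ _ g0) := ecv; apply: filterS => n.
  by rewrite sub0r normrN ger0_norm// ltW.
pose Q w := limn_einf (fun n => (Qn n w)%:E).
exists Q; split.
- apply: measurable_fun_limn_einf => n; apply/measurable_EFinP.
  by have [] := HQ n.
- move=> w; apply: le_limn_einf; apply: nearW => n; rewrite lee_fin.
  by have [_ +] := HQ n; exact.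
(* Off [b n] the approximation error is at most [e n * (K + 2)]; on [b n] the cutoff
   [Kn n <= 2 * K + 2] takes over. As [P (b n) <= e n], the errors integrate to at most
   [e n * (3 * K + 6)]. *)
- pose B n w := (mine (V t w) K%:E + (e n * (K + 4))%:E + ((2 * K + 2) * \1_(b n) w)%:E)%E.
  have mV : measurable_fun setT (V t) by exact: (measurable_integral_sqr iH).
  have mm : measurable_fun setT (fun w => mine (V t w) K%:E).
    by apply: measurable_mine => //; exact: measurable_cst.
  have m0 w : (0 <= mine (V t w) K%:E)%E.
    by rewrite le_min lee_fin K0 andbT integral_ge0// => r _; rewrite lee_fin sqr_ge0.
  have mB n : measurable_fun setT (B n).
    apply: emeasurable_funD; first exact: emeasurable_funD.
    by apply/measurable_EFinP; apply: measurable_funM => //; exact: measurable_indic.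
  have QB n : (\int[P]_w (Qn n w)%:E <=
      4%:E * (\int[P]_w mine (V t w) K%:E + (e n * (3 * K + 6))%:E))%E.
    have [_ _ + _] := HQ n => /(_ (B n) (mB n)).
    move=> h; apply: (le_trans (h _)) => {h}.
      move=> w; have [bw|nbw] := pselect (b n w).
        rewrite ge_min; apply/orP; right.
        rewrite /B indicE mem_set// mulr1.
        apply: (@le_trans _ _ ((2 * K + 2)%:E)).
          rewrite lee_fin /Kn; have := e0 n; have := e1 n.
          by have := K0; nra.
        rewrite -[leLHS]add0e leeD// adde_ge0// lee_fin mulr_ge0 ?(ltW (e0 n))//.
        by rewrite addr_ge0.
      rewrite /B indicE memNset// mulr0 adde0.
      have [VK|VK] := leP (V t w) K%:E.
        rewrite ge_min; apply/orP; left.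
        apply: (le_trans (approx n w t nbw _)); first by rewrite t0 lexx.
        have V0 : (0 <= V t w)%E.
          by rewrite integral_ge0// => r _; rewrite lee_fin sqr_ge0.
        move: V0 VK; case: (V t w) => [v| |]//; rewrite !lee_fin => v0 vK.
        by have := e0 n; nra.
      rewrite ge_min; apply/orP; right.
      by rewrite -EFinD lee_fin /Kn; have := e0 n; nra.
    apply: lee_wpmul2l => //.
    have i0 w : (0 <= ((2 * K + 2) * \1_(b n) w)%:E)%E.
      by rewrite lee_fin mulr_ge0// addr_ge0// mulr_ge0.
    have c0 : 0 <= e n * (K + 4) by rewrite mulr_ge0 ?(ltW (e0 n))// addr_ge0.
    have mi : measurable_fun setT (fun w => ((2 * K + 2) * \1_(b n) w)%:E).
      by apply/measurable_EFinP; apply: measurable_funM => //; exact: measurable_indic.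
    rewrite /B ge0_integralD//; last 2 first.
    + by move=> w _; rewrite adde_ge0.
    + exact: emeasurable_funD.
    rewrite ge0_integralD//.
    rewrite integral_cst//= probability_setT mule1 -addeA leeD2l//.
    under eq_integral do rewrite EFinM.
    rewrite ge0_integralZl//; last 2 first.
    + by apply/measurable_EFinP; exact: measurable_indic.
    + by rewrite lee_fin addr_ge0// mulr_ge0.
    rewrite integral_indic// setIT.
    apply: (@le_trans _ _ ((e n * (K + 4))%:E + (2 * K + 2)%:E * (e n)%:E)%E).
      by apply: leeD2l; apply: lee_wpmul2l; [rewrite lee_fin addr_ge0// mulr_ge0|exact: Pb].
    by rewrite -EFinM -EFinD lee_fin le_eqVlt; apply/orP; left; apply/eqP; ring.
  have Em : (\int[P]_w mine (V t w) K%:E \is a fin_num)%E.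
    rewrite ge0_fin_numE ?integral_ge0//.
    apply: (@le_lt_trans _ _ (\int[P]_w (cst K%:E w))%E).
      by apply: ge0_le_integral => // w _; rewrite ge_min lexx orbT.
    by rewrite integral_cst//= probability_setT mule1 ltry.
  apply: (@le_trans _ _ (limn_einf (fun n => \int[P]_w (Qn n w)%:E))%E).
    apply: fatou => //.
    + by move=> n; apply/measurable_EFinP; have [] := HQ n.
    + by move=> n w _; rewrite lee_fin; have [_ +] := HQ n; exact.
  apply/lee_addgt0Pr => h h0; apply: ge_limn_einf.
  have h'0 : 0 < h / (12 * K + 24) by rewrite divr_gt0// ltr_wpDl// mulr_ge0.
  near=> n; apply: (le_trans (QB n)).
  have en : e n <= h / (12 * K + 24).
    by near: n; exact: esmall.
  rewrite -(fineK Em) -EFinD -!EFinM -EFinD lee_fin mulrDr lerD2l.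
  move: en; rewrite ler_pdivlMr ?ltr_wpDl ?mulr_ge0// => en.
  by lra.
(* Borel-Cantelli: the probabilities of the [b n] sum to at most 2, so almost every [w] lies in
   finitely many of them only. *)
- exists (lim_sup_set b); split.
  + apply: bigcap_measurable => //.
    by move=> n _; exact: bigcup_measurable.
  + apply: lim_sup_set_cvg0 => //.
    apply: (@le_lt_trans _ _ (2%:E)); last exact: ltry.
    apply: lime_le; first exact: is_cvg_nneseries.
    apply: nearW => n; apply: (@le_trans _ _ (\sum_(0 <= k < n) (e k)%:E)%E).
      by apply: lee_sum => k _; exact: Pb.
    rewrite sumEFin lee_fin big_mkord.
    suff -> : \sum_(i < n) e i = 2 - 2 * e n by have := e0 n; lra.
    elim: n => [|n IH]; first by rewrite big_ord0 /e expr0; ring.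
    by rewrite big_ord_recr/= IH /e exprS; field.
  + move=> w /=; apply: contra_notP => nlim i VK.
    have [n0 Hn0] : exists n0, forall n, (n0 <= n)%N -> ~ b n w.
      apply: contra_notP nlim => nex n _; apply: contrapT => nbn; apply: nex.
      by exists n => m nm bm; apply: nbn; exists m.
    apply/lee_subgt0Pr => h h0; apply: le_limn_einf.
    pose S n := sp_integral W (phi n) (s i) w.
    have near_good : \forall n \near \oo, ~ b n w /\ (i < n)%N.
      exists (maxn n0 i.+1) => // n /=; rewrite geq_max => /andP[h1 h2].
      by split => //; exact: Hn0.
    have cS : S n @[n --> \oo] --> I (s i) w.
      apply/cvgrPdist_le => g g0; near=> n.
      have [nb iN] : ~ b n w /\ (i < n)%N by near: n.
      apply: (@le_trans _ _ (e n)).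
        rewrite leNgt; apply/negP => H1; apply: nb.
        rewrite /b /bad -bigcup_mkord; exists i.+1 => //=.
        by rewrite lee_fin distrC ltW.
      by near: n; exact: esmall.
    have cS2 : S n ^+ 2 @[n --> \oo] --> I (s i) w ^+ 2.
      by rewrite expr2; under eq_fun do rewrite expr2; exact: cvgM.
    have nS2 : \forall n \near \oo, `|I (s i) w ^+ 2 - S n ^+ 2| <= h.
      by have /cvgrPdist_le/(_ _ h0) := cS2.
    near=> n.
    have [nb iN] : ~ b n w /\ (i < n)%N by near: n.
    have [_ _ _ HS] := HQ n.
    have : S n ^+ 2 <= Qn n w.
      apply: HS; first by apply/mapP; exists i => //; rewrite mem_iota.
      apply: (le_trans (approx n w (s i) nb (st i))).
      have V0 : (0 <= V (s i) w)%E.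
        by rewrite integral_ge0// => r _; rewrite lee_fin sqr_ge0.
      move: V0 VK; case: (V (s i) w) => [v| |]//; rewrite !lee_fin => v0 vK.
      by rewrite /Kn; have := e0 n; nra.
    have : `|I (s i) w ^+ 2 - S n ^+ 2| <= h.
      by near: n; exact: nS2.
    rewrite ler_norml => /andP[_ h2] h3.
    by rewrite -EFinB lee_fin; lra.
Unshelve. all: by end_near. Qed.
End ito_maximal_inequality.

(** * Comparison of lower integrals, and a Gronwall lemma for differences *)

Section lower_integral_and_gronwall.
Variable R : realType.

(* [f] need not be measurable: the integral is then the supremum of the
   integrals of the simple functions below [f]. *)
Lemma le_integral_ae_nonmeasurable d (T : measurableType d)
    (P : {measure set T -> \bar R}) (f g : T -> \bar R) :
  (forall w, 0 <= f w)%E -> (forall w, 0 <= g w)%E -> measurable_fun setT g ->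
  {ae P, forall w, f w <= g w}%E -> (\int[P]_w f w <= \int[P]_w g w)%E.
Proof.
move=> f0 g0 mg [N [mN N0 fgN]].
(* Raising [g] to [+oo] on the null set makes the comparison hold everywhere and leaves its integral
   unchanged. *)
pose g' w := if w \in N then +oo%E else g w.
have fg' w : (f w <= g' w)%E.
  rewrite /g'; case: ifPn => [_|]; first exact: leey.
  by rewrite notin_setE => nNw; apply: contrapT => nfg; apply/nNw/fgN.
have g'0 w : (0 <= g' w)%E by exact: le_trans (fg' w).
apply: (@le_trans _ _ (\int[P]_w g' w)%E).
  rewrite !ge0_integralTE//; apply: ereal_sup_le => _ [h /= hf <-].
  by exists h => // w; exact: le_trans (fg' w).
rewrite (@ge0_ae_eq_integral _ _ _ P setT g' g)//.
  apply: measurable_fun_ifT => //; apply: (measurable_fun_bool true).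
  rewrite setTI (_ : _ @^-1` _ = N)//; apply/seteqP; split=> w /=.
    by move=> /set_mem.
  by move=> /mem_set.
exists N; split => // w /=; rewrite /g'; apply: contra_notP => nNw _.
by rewrite memNset.
Qed.

(** Iterating over N equal steps gives [y t * (1 - c t / N)^N <= y 0], and the power tends to
    [exp (- c t)]. The growth is bounded by the value at the right end [b], as in an implicit Euler
    scheme. *)
Lemma gronwall_difference (y : R -> R) (c t : R) : 0 <= c -> 0 <= t ->
  0 < y 0 ->
  (forall a b, 0 <= a -> a <= b -> b <= t -> y b * (1 - c * (b - a)) <= y a) ->
  y t <= y 0 * expR (c * t).
Proof.
move=> c0 t0 y0 H.
have x0 : 0 <= c * t by rewrite mulr_ge0.
have step (e : R) : 0 < e -> y t <= y 0 * expR (c * t + e).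
  move=> e0.
  set x := c * t in x0 *.
  (* The exponent to be reached is [N x / (N - x) = x + x^2 / (N - x)]; this N makes its last term
     smaller than [e]. *)
  pose N := (Num.truncn (x + x ^+ 2 / e)).+1.
  have NR : x + x ^+ 2 / e < N%:R by exact: truncnS_gt.
  have N0 : 0 < N%:R :> R by rewrite ltr0n.
  have xN : x < N%:R by apply: le_lt_trans NR; rewrite lerDl divr_ge0 ?sqr_ge0// ltW.
  have xN0 : 0 < N%:R - x by rewrite subr_gt0.
  have q1 : 0 < 1 - x / N%:R by rewrite subr_gt0 ltr_pdivrMr// mul1r.
  have ind k : (k <= N)%N -> y (k%:R * (t / N%:R)) * (1 - x / N%:R) ^+ k <= y 0.
    elim: k => [|k IH] kN; first by rewrite mul0r expr0 mulr1.
    apply: le_trans (IH (ltnW kN)); rewrite exprS (mulrA (y _)) ler_wpM2r ?exprn_ge0 ?(ltW q1)//.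
    have -> : x / N%:R = c * (k.+1%:R * (t / N%:R) - k%:R * (t / N%:R)).
      by rewrite -mulrBl -natrB// subSnn mul1r mulrA.
    have tN : 0 <= t / N%:R by rewrite divr_ge0// ltW.
    apply: H.
    - by rewrite mulr_ge0.
    - by rewrite ler_wpM2r// ler_nat.
    - by rewrite mulrCA ler_piMr// ler_pdivrMr// mul1r ler_nat.
  have := ind N (leqnn N); have -> : N%:R * (t / N%:R) = t by field; rewrite gt_eqF.
  have low : expR (- (x / (N%:R - x))) <= 1 - x / N%:R.
    have -> : 1 - x / N%:R = (1 + x / (N%:R - x))^-1.
      field; apply/andP; split; rewrite gt_eqF//.
      by rewrite subrK.
    rewrite expRN lef_pV2 ?posrE ?expR_gt0//; first exact: expR_ge1Dx.
    by rewrite ltr_pwDl// divr_ge0// ltW.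
  move=> yN.
  have pw : expR (- (x / (N%:R - x))) ^+ N <= (1 - x / N%:R) ^+ N.
    by rewrite lerXn2r ?nnegrE ?expR_ge0// ltW.
  have [yt|yt] := leP (y t) 0.
    by apply: (le_trans yt); rewrite mulr_ge0 ?expR_ge0// ltW.
  have : y t * expR (- (x / (N%:R - x))) ^+ N <= y 0.
    by apply: le_trans yN; rewrite ler_wpM2l// ltW.
  rewrite -expRM_natl mulrN expRN -ler_pdivlMr ?invr_gt0 ?expR_gt0// invrK.
  move=> /le_trans; apply; rewrite ler_wpM2l ?(ltW y0)// ler_expR.
  have -> : N%:R * (x / (N%:R - x)) = x + x ^+ 2 / (N%:R - x) by field; rewrite gt_eqF.
  rewrite lerD2l ler_pdivrMr// mulrC -ler_pdivrMr//.
  by rewrite lerBrDl ltW.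
rewrite leNgt; apply/negP => yt.
have B0 : 0 < y 0 * expR (c * t) by rewrite mulr_gt0 ?expR_gt0.
have r1 : 1 < y t / (y 0 * expR (c * t)) by rewrite ltr_pdivlMr// mul1r.
have l0 : 0 < ln (y t / (y 0 * expR (c * t))) by rewrite ln_gt0.
(* Half the logarithm of the supposed excess ratio is a slack that [step] cannot accommodate. *)
have := step (ln (y t / (y 0 * expR (c * t))) / 2).
rewrite divr_gt0// => /(_ isT); apply/negP; rewrite -ltNge expRD mulrA.
rewrite mulrC -ltr_pdivlMr// -[ltRHS]lnK ?posrE ?(lt_trans ltr01)//.
by rewrite ltr_expR gtr_pMr// invf_lt1// ltr1n.
Qed.

End lower_integral_and_gronwall.

(** * Deterministic estimates along one continuous non-negative path *)

Section path_growth.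
Variable R : realType.
Local Notation mu := (@lebesgue_measure R).
Variable z : R -> R.
Hypotheses (cz : {within [set r : R | 0 <= r], continuous z})
  (z0 : forall r, 0 <= r -> 0 <= z r).
Let V u := (\int[mu]_(r in `[0%R, u]) (Num.sqrt (z r) ^+ 2)%:E)%E.
Let v u := \int[mu]_(r in `[0, u]) z r.

Lemma path_integrable u : mu.-integrable `[0, u] (EFin \o z).
Proof.
apply: continuous_compact_integrable; first exact: segment_compact.
apply: continuous_subspaceW cz => r /=; by rewrite in_itv/= => /andP[].
Qed.

Lemma path_varianceE u : V u = (v u)%:E.
Proof.
rewrite /v /Rintegral fineK; last first.
  by apply: integrable_fin_num => //; exact: path_integrable.
apply: eq_integral => r; rewrite inE/= in_itv/= => /andP[r0 _].
by rewrite sqr_sqrtr// z0.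
Qed.

Lemma path_variance_continuous u : 0 <= u -> {within `[0, u], continuous v}.
Proof.
by move=> u0; apply: parameterized_integral_continuous => //; exact: path_integrable.
Qed.

Lemma path_variance_nd a b : a <= b -> v a <= v b.
Proof.
move=> ab; rewrite -lee_fin -!path_varianceE.
have /integrableP[mz _] := path_integrable b.
apply: ge0_subset_integral => //.
- apply: (eq_measurable_fun (EFin \o z)) => // r; rewrite inE/= in_itv/= => /andP[r0 _].
  by rewrite sqr_sqrtr// z0.
- by apply: subset_itvl; rewrite bnd_simp.
Qed.

Lemma path_variance0 : v 0 = 0.
Proof. by rewrite /v set_itv1 Rintegral_set1. Qed.

(** An enumeration of the rationals clamped to [0, b]; an index that encodes no rational yields time
    0. *)
Definition dense_time (b : R) (i : nat) : R :=
  Num.min (Num.max 0 (ratr (odflt 0 (@unpickle rat i)))) b.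

Lemma dense_time_itv b i : 0 <= b -> 0 <= dense_time b i <= b.
Proof. by move=> b0; rewrite /dense_time le_min le_max lexx b0 ge_min lexx orbT. Qed.

Lemma dense_timeP b x y : 0 <= x -> x < y -> y <= b ->
  exists i, x < dense_time b i < y.
Proof.
move=> x0 /rat_in_itvoo[q]; rewrite in_itv/= => /andP[xq qy] yb; exists (pickle q).
rewrite /dense_time pickleK/= (max_idPr _); last by rewrite (le_trans x0)// ltW.
by rewrite (min_idPl _) ?xq// (le_trans (ltW qy)).
Qed.

Lemma dense_time0 b : 0 <= b -> exists i, dense_time b i = 0.
Proof.
move=> b0; exists (pickle (0 : rat)).
by rewrite /dense_time pickleK/= raddf0 maxxx; apply/min_idPl.
Qed.

Variables (b K q : R).
Hypotheses (b0 : 0 <= b) (K0 : 0 <= K)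
  (Hq : forall i, v (dense_time b i) <= K -> z (dense_time b i) ^+ 2 <= q).

(** A violation at [u] persists, by continuity, at a dense time slightly to the left of [u], and
    there the cutoff [v <= K] is inherited by monotonicity. Nothing lies to the left of 0, but 0 is
    itself a dense time. *)
Lemma path_bound u : 0 <= u -> u <= b -> v u <= K -> z u ^+ 2 <= q.
Proof.
move=> u0 ub vuK.
move: u0; rewrite le_eqVlt => /predU1P[<-|u0].
  have [i e] := dense_time0 b0; rewrite -e; apply: Hq.
  by rewrite e path_variance0.
rewrite leNgt; apply/negP => qz.
have zu : (fun r => z r ^+ 2) @ within [set r | 0 <= r] (nbhs u) --> z u ^+ 2.
  have /subspace_continuousP/(_ u (ltW u0)) h := cz.
  rewrite expr2; under eq_fun do rewrite expr2; exact: (cvgM h h).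
have : \forall r \near within [set r | 0 <= r] (nbhs u), q < z r ^+ 2.
  exact: (cvgr_gt _ zu).
rewrite near_withinE => -[/= e e0 He].
have [|||i /andP[i1 i2]] := @dense_timeP b (Num.max 0 (u - e)) u => //.
- by rewrite le_max lexx.
- by rewrite gt_max u0/= ltrBlDr ltrDl.
move: i1; rewrite gt_max => /andP[i0 i1].
have : q < z (dense_time b i) ^+ 2.
  apply: He => /=; last exact: ltW.
  by rewrite ger0_norm ?subr_ge0 ?(ltW i2)// ltrBlDr -ltrBlDl.
apply/negP; rewrite -leNgt Hq//.
by rewrite (le_trans _ vuK)// path_variance_nd// ltW.
Qed.

(** While [v <= K] one has [z <= (1 + z^2) / 2 <= (1 + q) / 2], which bounds the growth of [v]. If
    [v] passes K before [b], the intermediate value theorem gives a time where it equals K, and the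
    bound up to that time suffices. *)
Lemma path_growth a : 0 <= a -> a <= b ->
  Num.min (v b) K <= Num.min (v a) K + (b - a) * ((1 + q) / 2).
Proof.
move=> a0 ab.
have q0 : 0 <= q.
  have := @path_bound 0 (lexx _) b0; rewrite path_variance0 => /(_ K0).
  by apply: le_trans; exact: sqr_ge0.
have q2 : 0 <= (1 + q) / 2 by rewrite divr_ge0// addr_ge0.
have sub c : a <= c -> c <= b -> v c <= K -> v c <= v a + (c - a) * ((1 + q) / 2).
  move=> ac cb vcK.
  have ic := path_integrable c.
  have ioc : mu.-integrable `]a, c] (EFin \o z).
    by apply: integrableS ic => //; apply: subset_itv; rewrite bnd_simp.
  have -> : v c = v a + \int[mu]_(r in `]a, c]) z r.
    rewrite /v (@itv_bndbnd_setU _ _ (BLeft 0) (BRight a) (BRight c)) ?bnd_simp//.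
    rewrite Rintegral_setU//=; last 2 first.
    - rewrite -(@itv_bndbnd_setU _ _ (BLeft 0) (BRight a) (BRight c)) ?bnd_simp//.
    - apply/disj_setPLR => r /=; rewrite !in_itv/= => /andP[_ ra].
      by apply/negP; rewrite negb_and -leNgt ra.
  rewrite lerD2l.
  apply: (@le_trans _ _ (\int[mu]_(r in `]a, c]) cst ((1 + q) / 2) r)).
    apply: le_Rintegral => //.
      apply/integrableP; split; first by apply/measurable_EFinP; exact: measurable_cst.
      rewrite (eq_integral (cst `|((1 + q) / 2)%:E|%E))// integral_cst//= lebesgue_measure_itv/=.
      by case: ifP => _; rewrite ?mule0 ?ltry// -EFinD -EFinM ltry.
    move=> r; rewrite /= in_itv/= => /andP[ar rc].
    have r0 : 0 <= r by rewrite (le_trans a0)// ltW.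
    have := @path_bound r r0 (le_trans rc cb).
    rewrite (le_trans (path_variance_nd rc) vcK) => /(_ isT) zr.
    by have := sqr_ge0 (z r - 1); rewrite ler_pdivlMr//; nra.
  rewrite Rintegral_cst//= lebesgue_measure_itv/= lte_fin.
  case: ifPn => ac'; first by rewrite -EFinB /= mulrC.
  by rewrite /= mulr0 mulr_ge0// subr_ge0.
have [vaK|Kva] := leP (v a) K; last first.
  by rewrite ge_min lerDl mulr_ge0 ?subr_ge0// orbT.
have [vbK|Kvb] := leP (v b) K; first exact: sub.
have cab : {within `[a, b], continuous v}.
  apply: continuous_subspaceW (path_variance_continuous b0) => r /=.
  by rewrite !in_itv/= => /andP[ar ->]; rewrite (le_trans a0).
have [|c] := @IVT R v a b K ab cab.
  by rewrite ge_min vaK/= le_max (ltW Kvb) orbT.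
rewrite in_itv/= => /andP[ac cb] vcK.
rewrite -{1}vcK (le_trans (sub c ac cb _)) ?vcK// lerD2l.
by rewrite ler_wpM2r// lerD2r.
Qed.

End path_growth.

(** * Second moment of the supremum under an affine upper bound *)

Section second_moment_of_supremum.
Context d (T : measurableType d) (R : realType) (P : probability T R).
Variables (W Z I : R -> T -> R) (sigma t m : R).
Hypothesis HW : wiener_process P W.
Local Notation F := (augmented_filtration P W).
Local Notation mu := (@lebesgue_measure R).
Hypotheses (cZ : continuous_paths P Z)
  (Z0 : {ae P, forall w, forall u : R, 0 <= u -> 0 <= Z u w})
  (itoI : is_ito_integral P F W (fun s w => Num.sqrt (Z s w)) I)
  (t0 : 0 <= t)
  (ZI : {ae P, forall w, forall u : R, 0 <= u -> u <= t -> Z u w <= m + sigma * I u w}).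

Let V u w := (\int[mu]_(r in `[0%R, u]) ((Num.sqrt (Z r w)) ^+ 2)%:E)%E.

Let iH : ito_integrand P F (fun s w => Num.sqrt (Z s w)).
Proof. by case: itoI. Qed.

Let mV u : measurable_fun setT (V u).
Proof. exact: (measurable_integral_sqr iH). Qed.

Let V0 u w : (0 <= V u w)%E.
Proof. by apply: integral_ge0 => r _; rewrite lee_fin sqr_ge0. Qed.

Let mminV u (K : R) : measurable_fun setT (fun w => mine (V u w) K%:E).
Proof. by apply: measurable_mine => //; exact: measurable_cst. Qed.

Let minV0 u (K : R) w : 0 <= K -> (0 <= mine (V u w) K%:E)%E.
Proof. by move=> K0; rewrite le_min V0 lee_fin. Qed.

Let U (K u : R) : R := fine (\int[P]_w mine (V u w) K%:E)%E.

Let UE (K u : R) : 0 <= K -> (\int[P]_w mine (V u w) K%:E = (U K u)%:E)%E.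
Proof.
move=> K0; rewrite fineK// ge0_fin_numE; last first.
  by apply: integral_ge0 => w _; exact: minV0.
apply: (@le_lt_trans _ _ (\int[P]_w (cst K%:E w))%E).
  apply: ge0_le_integral => //; first by move=> w _; exact: minV0.
  by move=> w _; rewrite ge_min lexx orbT.
by rewrite integral_cst//= probability_setT mule1 ltry.
Qed.

(** From [0 <= Z <= m + sigma * I] one gets [Z^2 <= 2 m^2 + 2 sigma^2 I^2], so
    [q = 2 m^2 + 2 sigma^2 Q] works; 8 is 2 times Doob's 4. One and the same [q] bounds the path and
    the growth of its variance, which closes the Gronwall loop. *)
Let dominating (K u : R) : 0 <= K -> 0 <= u -> u <= t -> exists q : T -> \bar R,
  [/\ measurable_fun setT q, (forall w, 0 <= q w)%E,
      (\int[P]_w q w <= (2 * m ^+ 2 + 8 * sigma ^+ 2 * U K u)%:E)%E,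
      {ae P, forall w, forall r : R, 0 <= r -> r <= u -> (V r w <= K%:E)%E ->
         ((Z r w ^+ 2)%:E <= q w)%E} &
      forall a : R, 0 <= a -> a <= u -> {ae P, forall w,
         (mine (V u w) K%:E <=
          mine (V a w) K%:E + ((u - a) / 2)%:E * (1 + q w))%E}].
Proof.
move=> K0 u0 ut.
have du i : 0 <= dense_time u i <= u by exact: dense_time_itv.
have [Q [mQ Q0 EQ HQ]] := ito_doob HW itoI u0 K0 du.
pose q w := ((2 * m ^+ 2)%:E + (2 * sigma ^+ 2)%:E * Q w)%E.
have c1 : 0 <= 2 * m ^+ 2 by rewrite mulr_ge0// sqr_ge0.
have c2 : 0 <= 2 * sigma ^+ 2 by rewrite mulr_ge0// sqr_ge0.
have q0 w : (0 <= q w)%E by rewrite adde_ge0// mule_ge0.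
have msQ : measurable_fun setT (fun w => (2 * sigma ^+ 2)%:E * Q w)%E.
  exact: emeasurable_funM.
have mq : measurable_fun setT q by exact: emeasurable_funD.
have qi : {ae P, forall w, forall i, (V (dense_time u i) w <= K%:E)%E ->
    ((Z (dense_time u i) w ^+ 2)%:E <= q w)%E}.
  apply: filterS3 HQ Z0 ZI => w HQw Z0w ZIw i /HQw IQ.
  have /andP[i0 iu] := du i.
  apply: (@le_trans _ _ ((2 * m ^+ 2)%:E
      + (2 * sigma ^+ 2)%:E * (I (dense_time u i) w ^+ 2)%:E)%E); last first.
    by rewrite leeD2l// lee_wpmul2l.
  rewrite -EFinM -EFinD lee_fin.
  have h1 := Z0w _ i0; have h2 := ZIw _ i0 (le_trans iu ut).
  set x := Z _ w in h1 h2 *; set y := I _ w in h2 *.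
  have : x ^+ 2 <= (m + sigma * y) ^+ 2 by rewrite lerXn2r// nnegrE (le_trans h1).
  by have := sqr_ge0 (m - sigma * y); nra.
have vE w (cw : {within [set r : R | 0 <= r], continuous (Z ^~ w)})
    (z0 : forall r, 0 <= r -> 0 <= Z r w) r :
    V r w = (\int[mu]_(x in `[0, r]) Z x w)%:E by exact: path_varianceE.
exists q; split => //.
- rewrite ge0_integralD//; last by move=> w _; rewrite mule_ge0.
  rewrite integral_cst//= probability_setT mule1 ge0_integralZl//.
  rewrite EFinD leeD2l//.
  apply: (@le_trans _ _ ((2 * sigma ^+ 2)%:E * (4%:E * (U K u)%:E))%E).
    by apply: lee_wpmul2l; rewrite ?lee_fin// -UE.
  by rewrite -!EFinM lee_fin le_eqVlt; apply/orP; left; apply/eqP; ring.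
- apply: filterS3 qi cZ Z0 => w qiw cw z0 r r0 ru.
  move: (q0 w) qiw; case: (q w) => [x| |]//; last by move=> *; rewrite leey.
  rewrite lee_fin => x0 qiw; rewrite vE// !lee_fin => vK.
  apply: (path_bound cw z0 u0 K0 _ r0 ru vK) => i; rewrite -lee_fin -vE// => /qiw.
  by rewrite lee_fin.
- move=> a a0 au.
  apply: filterS3 qi cZ Z0 => w qiw cw z0.
  (* An infinite [q w] makes the right-hand side infinite, except for [a = u], where its factor is
     0. *)
  move: (q0 w) qiw; case: (q w) => [x| |]//; last first.
    move=> _ _; move: au; rewrite le_eqVlt => /predU1P[<-|au].
      by rewrite subrr mul0r mul0e adde0.
    rewrite addey// gt0_muley ?lte_fin ?divr_gt0 ?subr_gt0// addey ?leey//.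
    by rewrite gt_eqF// (lt_le_trans _ (minV0 a w K0)).
  rewrite lee_fin => x0 qiw; rewrite !vE// -!EFin_min -(EFinD 1 x) -EFinM -EFinD lee_fin.
  have -> : (u - a) / 2 * (1 + x) = (u - a) * ((1 + x) / 2) by field.
  apply: (path_growth cw z0 u0 K0 _ a0 au) => i; rewrite -lee_fin -vE// => /qiw.
  by rewrite lee_fin.
Qed.

Let U0 K : 0 <= K -> U K 0 = 0.
Proof.
move=> K0; rewrite /U; under eq_integral => w _.
  have -> : V 0 w = 0%E by rewrite /V set_itv1 integral_set1.
  rewrite (min_idPl _) ?lee_fin//.
  over.
by rewrite integral0.
Qed.

(** For [y = 2 m^2 + 1 + 8 sigma^2 U], the expectation of [1 + q] is at most [y b], hence
    [U b <= U a + (b - a) / 2 * y b]; multiplied by [8 sigma^2] this is the hypothesis of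
    [gronwall_difference] with rate [4 sigma^2]. *)
Let U_bound K : 0 <= K ->
  2 * m ^+ 2 + 1 + 8 * sigma ^+ 2 * U K t <=
  (2 * m ^+ 2 + 1) * expR (4 * sigma ^+ 2 * t).
Proof.
move=> K0; pose y u := 2 * m ^+ 2 + 1 + 8 * sigma ^+ 2 * U K u.
have y0 : y 0 = 2 * m ^+ 2 + 1 by rewrite /y U0// mulr0 addr0.
rewrite -/(y t) -y0; apply: gronwall_difference => //.
- by rewrite mulr_ge0// sqr_ge0.
- by rewrite y0 ltr_wpDl// mulr_ge0// sqr_ge0.
move=> a b a0 ab bt; have b0 := le_trans a0 ab.
have [q [mq q0 Eq _ /(_ a a0 ab) gq]] := dominating K0 b0 bt.
have ba : 0 <= (b - a) / 2 by rewrite divr_ge0// subr_ge0.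
have mq1 : measurable_fun setT (fun w => ((b - a) / 2)%:E * (1 + q w))%E.
  by apply: emeasurable_funM => //; exact: emeasurable_funD.
have q10 w : (0 <= ((b - a) / 2)%:E * (1 + q w))%E.
  by rewrite mule_ge0// adde_ge0.
have : (\int[P]_w mine (V b w) K%:E <= \int[P]_w (mine (V a w) K%:E +
    ((b - a) / 2)%:E * (1 + q w)))%E.
  apply: le_integral_ae_nonmeasurable => //.
  - by move=> w; exact: minV0.
  - by move=> w; rewrite adde_ge0// minV0.
  - exact: emeasurable_funD.
rewrite ge0_integralD//; last by move=> w _; exact: minV0.
rewrite ge0_integralZl//; last 2 first.
- exact: emeasurable_funD.
- by move=> w _; rewrite adde_ge0.
rewrite ge0_integralD// integral_cst//= probability_setT mule1 !UE// => h.
have : ((U K b)%:E <= (U K a)%:E + ((b - a) / 2)%:E *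
    (1 + (2 * m ^+ 2 + 8 * sigma ^+ 2 * U K b)%:E))%E.
  by apply: (le_trans h); rewrite leeD2l// lee_wpmul2l ?lee_fin// leeD2l.
rewrite -(EFinD 1) -EFinM -EFinD lee_fin => {}h.
move: (ler_wpM2l (sqr_ge0 sigma) h); rewrite -subr_ge0 => {}h.
rewrite -subr_ge0 /y; move: h.
set A := U K b; set B := U K a; set s := sigma ^+ 2; set M := m ^+ 2 => {}h.
have -> : 2 * M + 1 + 8 * s * B - (2 * M + 1 + 8 * s * A) * (1 - 4 * s * (b - a)) =
    8 * (s * (B + (b - a) / 2 * (1 + (2 * M + 8 * s * A))) - s * A) by field.
by rewrite mulr_ge0.
Qed.

Lemma expectation_sup_sqr_le :
  ('E_P[(fun w => sup [set Z s w | s in [set s : R | (0 <= s <= t)%R]] ^+ 2)%R]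
   <= (2 * (m ^+ 2 + 2 * sigma ^+ 2 * t) * expR (4 * sigma ^+ 2 * t))%:E)%E.
Proof.
have [q Hq] := choice (fun n : nat => dominating (ler0n R n) t0 (lexx t)).
set B := (X in (_ <= X%:E)%E).
(* [U_bound] leaves [(2 m^2 + 1) E - 1] with [E = exp x]; then [E - 1 <= x E] yields [B], since
   [x = 2 * (2 sigma^2 t)]. *)
have Bq n : (\int[P]_w q n w <= B%:E)%E.
  have [_ _ + _ _] := Hq n => /le_trans; apply; rewrite lee_fin.
  have := U_bound (ler0n R n); rewrite /B.
  set x := 4 * sigma ^+ 2 * t; set y := U _ _; set E := expR x => h.
  have e1 : E * expR (- x) = 1 by rewrite -expRD subrr expR0.
  have := expR_ge1Dx (- x); have E0 := expR_gt0 x; rewrite -/E in E0.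
  move=> h2; have : E * (1 - x) <= 1 by rewrite -[leRHS]e1 ler_wpM2l// ltW.
  have -> : 2 * (m ^+ 2 + 2 * sigma ^+ 2 * t) = 2 * m ^+ 2 + x by rewrite /x; ring.
  by lra.
rewrite unlock.
(* The majorants for different cutoffs are chosen independently of each other and need not be
   monotone in [n]; their lower limit still dominates, and Fatou's lemma bounds its integral. *)
apply: (@le_trans _ _ (\int[P]_w limn_einf (q ^~ w))%E).
  apply: le_integral_ae_nonmeasurable.
  - by move=> w; rewrite lee_fin sqr_ge0.
  - move=> w; apply: le_limn_einf; apply: nearW => n.
    by have [_ + _ _ _] := Hq n; exact.
  - by apply: measurable_fun_limn_einf => n; have [] := Hq n.
  have allq : {ae P, forall w, forall n, forall r : R, 0 <= r -> r <= t ->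
      (V r w <= n%:R%:E)%E -> ((Z r w ^+ 2)%:E <= q n w)%E}.
    by apply: ae_foralln => n; have [] := Hq n.
  apply: filterS3 allq cZ Z0 => w qw cw z0.
  have vE r : V r w = (\int[mu]_(x in `[0, r]) Z x w)%:E by exact: path_varianceE.
  apply: le_limn_einf.
  (* From this index on the cutoff [V <= n] holds on the whole of [0, t], so [q n w] bounds the
     square of the supremum. *)
  exists (Num.truncn (\int[mu]_(x in `[0, t]) Z x w)).+1 => // n /= hn.
  have nV : \int[mu]_(x in `[0, t]) Z x w <= n%:R.
    by rewrite ltW// (lt_le_trans (truncnS_gt _))// ler_nat.
  have qn0 : (0 <= q n w)%E by have [_ + _ _ _] := Hq n; exact.
  have Zq r : 0 <= r -> r <= t -> ((Z r w ^+ 2)%:E <= q n w)%E.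
    move=> r0 rt; apply: qw => //; rewrite vE lee_fin (le_trans _ nV)//.
    exact: (path_variance_nd cw z0).
  move: qn0 Zq; case: (q n w) => [x| |]//; last by move=> *; rewrite leey.
  rewrite lee_fin => x0 Zx.
  have ub r : 0 <= r <= t -> Z r w <= Num.sqrt x.
    move=> /andP[r0 rt]; rewrite -(ler_pXn2r (n := 2))// ?nnegrE ?sqrtr_ge0 ?z0//.
    by rewrite sqr_sqrtr// -lee_fin Zx.
  rewrite lee_fin -[leRHS]sqr_sqrtr// lerXn2r ?nnegrE ?sqrtr_ge0//.
    apply: (@le_trans _ _ (Z 0 w)); first exact: z0.
    apply: ub_le_sup; last by exists 0 => //=; rewrite lexx t0.
    by exists (Num.sqrt x) => _ [r /= rt <-]; exact: ub.
  apply: ge_sup; first by exists (Z 0 w), 0 => //=; rewrite lexx t0.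
  by move=> _ [r /= rt <-]; exact: ub.
apply: (le_trans (fatou _ _ _ _)) => //.
- by move=> n; have [] := Hq n.
- by move=> n w _; have [_ + _ _ _] := Hq n; exact.
by apply: ge_limn_einf; apply: nearW.
Qed.
End second_moment_of_supremum.

(** * Comparison of the drifts, and the bound for both processes *)

Lemma affine_drift_le (R : realType) (x : R -> R) (x0 a b s : R) :
  {within [set r : R | 0 <= r], continuous x} -> (forall r, 0 <= r -> 0 <= x r) ->
  0 <= b -> 0 <= s ->
  x0 + \int[lebesgue_measure]_(r in `[0%R, s]) (a - b * x r) <= x0 + a * s.
Proof.
move=> cx xge0 b0 s0; rewrite lerD2l.
have cst_int (c : R) : lebesgue_measure.-integrable `[0, s] (EFin \o cst c).
  apply: continuous_compact_integrable; first exact: segment_compact.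
  by apply: continuous_subspaceT => r; exact: cst_continuous.
have ix := path_integrable cx s.
apply: (@le_trans _ _ (\int[lebesgue_measure]_(r in `[0%R, s]) cst a r)).
  apply: le_Rintegral => //.
  - rewrite (_ : EFin \o _ = ((EFin \o cst a) \- (fun r => b%:E * (EFin \o x) r))%E)//.
    by apply: integrableB => //; exact: integrableZl.
  - move=> r; rewrite /= in_itv/= => /andP[r0 _].
    by rewrite lerBlDr lerDl mulr_ge0// xge0.
rewrite Rintegral_cst//= lebesgue_measure_itv/= lte_fin.
by move: s0; rewrite le_eqVlt => /predU1P[<-|->]; rewrite ?ltxx/= ?subr0.
Qed.

Theorem proposition3p1 (R : realType) (d : measure_display)
    (T : measurableType d) (P : probability T R) (W : R -> T -> R)
    (x0 y0 a b sigma : R) (X Y : R -> T -> R) (Z : R -> T -> R) (z0 : R) :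
  wiener_process P W ->
  0 < x0 -> 0 < y0 -> 0 < a -> 0 <= b -> 0 < sigma ->
  sigma ^+ 2 <= 2 * a ->
  CIR_process P W x0 a b sigma X ->
  squared_bessel_process P W y0 a sigma Y ->
  (Z = X /\ z0 = x0) \/ (Z = Y /\ z0 = y0) ->
  forall t : R, 0 <= t ->
    ('E_P[(fun w => sup [set Z s w | s in [set s : R | 0 <= s <= t]] ^+ 2)%R]
     <= (2 * ((z0 + a * t) ^+ 2 + 2 * sigma ^+ 2 * t)
           * expR (4 * sigma ^+ 2 * t))%:E)%E.
Proof.
move=> HW _ _ a0 b0 _ _ HX HY HZ t t0.
have mono z s : s <= t -> z + a * s <= z + a * t.
  by move=> st; rewrite lerD2l ler_wpM2l// ltW.
case: HZ => -[-> ->].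
- have [_ cX X0 [I [itoI XE]]] := HX.
  apply: (expectation_sup_sqr_le HW cX X0 itoI t0).
  apply: filterS3 cX X0 XE => w cw w0 wE s s0 st.
  rewrite wE// lerD2r (le_trans _ (mono x0 s st))//.
  exact: affine_drift_le.
- have [_ cY Y0 [I [itoI YE]]] := HY.
  apply: (expectation_sup_sqr_le HW cY Y0 itoI t0).
  by apply: filterS YE => w wE s s0 st; rewrite wE// lerD2r mono.
Qed.
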